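(* Let $A$, $B$, $C$ be separable commutative unital $C^*$-algebras, and let $\phi_A:C\to A$ and $\phi_B:C\to B$ be injective unital $*$-homomorphisms (so that $A,B\supseteq C$). Then the amalgamated free product $A\star_C B$ is residually finite-dimensional.
   Context: For unital $*$-homomorphisms $\phi_A:C\to A$, $\phi_B:C\to B$ of unital $C^*$-algebras, the amalgamated free product $A\star_C B$ is the unital $C^*$-algebra equipped with unital $*$-homomorphisms $\varphi_A:A\to A\star_C B$, $\varphi_B:B\to A\star_C B$ with $\varphi_A\circ\phi_A=\varphi_B\circ\phi_B$, which is universal: for every $C^*$-algebra $D$ and $*$-homomorphisms $\tilde\varphi_A:A\to D$, $\tilde\varphi_B:B\to D$ with $\tilde\varphi_A\circ\phi_A=\tilde\varphi_B\circ\phi_B$ there is a unique $*$-homomorphism $\Phi:A\star_C B\to D$ with $\Phi\circ\varphi_A=\tilde\varphi_A$, $\Phi\circ\varphi_B=\tilde\varphi_B$. A $C^*$-algebra $\mathcal A$ is residually finite-dimensional (RFD) if it is separable and for every $a\in\mathcal A$ one has $\|a\|=\sup\|\pi(a)\|$, the supremum over all finite-dimensional $*$-representations $\pi$ of $\mathcal A$ (equivalently, $\mathcal A$ embeds into a direct product of matrix algebras). *)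

(* Defs.v *)
From HB Require Import structures.
From mathcomp Require Import all_boot all_order all_algebra.
From mathcomp Require Import reals.
From mathcomp Require Import complex.
Set Implicit Arguments. Unset Strict Implicit. Unset Printing Implicit Defensive.
Import Order.TTheory GRing.Theory Num.Theory.
Local Open Scope ring_scope.

Definition cconj (R : realType) (z : R[i]) : R[i] := @Complex R (@complex.Re R z) (- @complex.Im R z).
Definition cabs (R : realType) (z : R[i]) : R := Num.sqrt (@complex.Re R z ^+ 2 + @complex.Im R z ^+ 2).

Record cstar_axioms (R : realType) (V : lmodType R[i]) (mul : V -> V -> V)
    (star : V -> V) (nrm : V -> R) : Prop := CStarAxioms {
  cs_mulA : forall x y z, mul x (mul y z) = mul (mul x y) z;
  cs_mulDl : forall x y z, mul (x + y) z = mul x z + mul y z;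
  cs_mulDr : forall x y z, mul x (y + z) = mul x y + mul x z;
  cs_mulZl : forall (a : R[i]) x y, mul (a *: x) y = a *: mul x y;
  cs_mulZr : forall (a : R[i]) x y, mul x (a *: y) = a *: mul x y;
  cs_starK : forall x, star (star x) = x;
  cs_starD : forall x y, star (x + y) = star x + star y;
  cs_starZ : forall (a : R[i]) x, star (a *: x) = cconj a *: star x;
  cs_starM : forall x y, star (mul x y) = mul (star y) (star x);
  cs_nrm_eq0 : forall x, nrm x = 0 -> x = 0;
  cs_nrm_triangle : forall x y, nrm (x + y) <= nrm x + nrm y;
  cs_nrmZ : forall (a : R[i]) x, nrm (a *: x) = cabs a * nrm x;
  cs_nrmM : forall x y, nrm (mul x y) <= nrm x * nrm y;
  cs_cstar_id : forall x, nrm (mul (star x) x) = nrm x ^+ 2;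
  cs_complete : forall u : nat -> V,
    (forall eps : R, 0 < eps -> exists N, forall m n, (N <= m)%N -> (N <= n)%N ->
        nrm (u m - u n) < eps) ->
    exists l, forall eps : R, 0 < eps -> exists N, forall n, (N <= n)%N ->
        nrm (u n - l) < eps
}.

Record CStarAlg (R : realType) := {
  cs_car :> lmodType R[i];
  cs_mul : cs_car -> cs_car -> cs_car;
  cs_star : cs_car -> cs_car;
  cs_norm : cs_car -> R;
  cs_ax : cstar_axioms cs_mul cs_star cs_norm
}.

Definition is_unit_elt (R : realType) (A : CStarAlg R) (e : A) : Prop :=
  forall x : A, cs_mul e x = x /\ cs_mul x e = x.

Definition unital (R : realType) (A : CStarAlg R) : Prop :=
  exists e : A, is_unit_elt e.

Definition commutative_cstar (R : realType) (A : CStarAlg R) : Prop :=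
  forall x y : A, cs_mul x y = cs_mul y x.

Definition separable (R : realType) (A : CStarAlg R) : Prop :=
  exists u : nat -> A, forall (x : A) (eps : R), 0 < eps ->
    exists n, @cs_norm R A (x - u n) < eps.

Definition star_hom (R : realType) (A B : CStarAlg R) (f : A -> B) : Prop :=
  [/\ forall x y, f (x + y) = f x + f y,
      forall (a : R[i]) x, f (a *: x) = a *: f x,
      forall x y, f (cs_mul x y) = cs_mul (f x) (f y)
    & forall x, f (cs_star x) = cs_star (f x)].

Definition unital_star_hom (R : realType) (A B : CStarAlg R) (f : A -> B) : Prop :=
  star_hom f /\ forall (e : A) (e' : B), is_unit_elt e -> is_unit_elt e' -> f e = e'.

Definition is_amalgamated_free_product (R : realType) (A B C P : CStarAlg R)
    (phiA : C -> A) (phiB : C -> B) (vA : A -> P) (vB : B -> P) : Prop :=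
  [/\ unital P, unital_star_hom vA, unital_star_hom vB,
      (forall c, vA (phiA c) = vB (phiB c))
    & forall (D : CStarAlg R) (fA : A -> D) (fB : B -> D),
        star_hom fA -> star_hom fB -> (forall c, fA (phiA c) = fB (phiB c)) ->
        exists Phi : P -> D,
          [/\ star_hom Phi, (forall a, Phi (vA a) = fA a),
              (forall b, Phi (vB b) = fB b)
            & forall Psi : P -> D, star_hom Psi -> (forall a, Psi (vA a) = fA a) ->
                (forall b, Psi (vB b) = fB b) -> forall p, Psi p = Phi p]].

Definition mx_adj (R : realType) (n : nat) (M : 'M[R[i]]_n) : 'M[R[i]]_n :=
  \matrix_(i, j) cconj (M j i).

Definition vnorm (R : realType) (n : nat) (v : 'cV[R[i]]_n) : R :=
  Num.sqrt (\sum_i cabs (v i ord0) ^+ 2).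

Definition is_lub (R : realType) (S : R -> Prop) (s : R) : Prop :=
  (forall r, S r -> r <= s) /\ (forall t, (forall r, S r -> r <= t) -> s <= t).

Definition is_opnorm (R : realType) (n : nat) (M : 'M[R[i]]_n) (s : R) : Prop :=
  is_lub (fun r => exists v : 'cV[R[i]]_n, vnorm v <= 1 /\ r = vnorm (M *m v)) s.

Definition fd_rep (R : realType) (A : CStarAlg R) (n : nat) (pi : A -> 'M[R[i]]_n) : Prop :=
  [/\ forall x y, pi (x + y) = pi x + pi y,
      forall (a : R[i]) x, pi (a *: x) = a *: pi x,
      forall x y, pi (cs_mul x y) = pi x *m pi y
    & forall x, pi (cs_star x) = mx_adj (pi x)].

Definition RFD (R : realType) (A : CStarAlg R) : Prop :=
  separable A /\
  forall a : A, is_lub (fun r => exists (n : nat) (pi : A -> 'M[R[i]]_n) (s : R),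
      [/\ fd_rep pi, is_opnorm (pi a) s & r = s]) (@cs_norm R A a).

(* Main.v *)
(* Write [P] for the amalgamated free product and fix [p] in [P].  Since [A] and [B]
   are commutative, the image of [C] is central in [P], and there is a state [phi] of
   [P] with [phi (p^* p) = |p|^2] that is multiplicative on the center; so [C] acts by
   scalars in the GNS representation of [phi].  A partition of unity [(g_k)] of [A],
   modulo the ideal that [phi] kills, with each [g_k] concentrated near a character
   [x_k], splits the form [phi (u^* w)] as the sum of the forms [phi (u^* g_k w)];
   factoring these by Gram-Schmidt gives vectors [X u] in a finite-dimensional space on
   which the diagonal representation [D_A] of [A] by the [x_k] satisfies
   [D_A(a) (X u) ~ X (a u)] for the finitely many [a], [u] that matter.  The same is
   done with [B], giving [D_B] and vectors [Y u].  As [X] and [Y] have the same Gram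
   matrix on these [u], a unitary maps [X u] to [Y u] and conjugates [D_A] into a
   representation which agrees with [D_B] on [C], both being scalar there.  The
   resulting finite-dimensional representation [sigma] of [P] satisfies
   [sigma(p) (Y 1) ~ Y p], where [|Y 1| = 1] and [|Y p| = |p|]. *)

Require Import Defs.
From HB Require Import structures.
From mathcomp Require Import all_boot all_order all_algebra.
From mathcomp Require Import boolp classical_sets reals complex ring lra.

Set Implicit Arguments.
Unset Strict Implicit.
Unset Printing Implicit Defensive.
Import Order.TTheory GRing.Theory Num.Theory.
Local Open Scope ring_scope.
Local Open Scope complex_scope.

(** * Unital C*-algebras as rings *)

(** The axioms offer a norm and the C*-identity but no spectrum. Functional calculus is replaced by
    square roots that commute with whatever commutes with the radicand, and states come from maximal
    cones. Multiplicativity on the center is not drawn from extreme points: a cone maximal among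
    those stable under positive central multipliers gives a sign to every central self-adjoint
    element, and this forces it. Applied to a commutative algebra, the same theorem produces
    characters, hence partitions of unity.

    The obstacle is that the universal property tolerates no error on [C], whereas
    finite-dimensional compressions are only approximate. Scalars remove it: every character that
    kills the ideal of [phi] takes at [c] the value [phi c], so moving the letters to nearby
    characters leaves [C] untouched, and so does conjugation by a unitary. The Gram matrices must
    also match exactly for that unitary to exist, which is why Gram-Schmidt is run on a finite list
    of vectors. All error then sits in the letters, and a closure argument carries it from letters
    to [p]. *)

Record ucstar (R : realType) := UCStar {
  uc_alg : CStarAlg R;
  uc_one : uc_alg;
  uc_oneP : is_unit_elt uc_one;
  uc_one_neq0 : uc_one != 0 }.

Definition ucar (R : realType) (U : ucstar R) : Type := cs_car (uc_alg U).
Coercion ucar : ucstar >-> Sortclass.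

Section RingStructure.
Variables (R : realType) (U : ucstar R).
HB.instance Definition _ := GRing.Lmodule.copy (ucar U) (cs_car (uc_alg U)).

Let ax := cs_ax (uc_alg U).
Fact uc_mulrA : associative (@cs_mul R (uc_alg U)).
Proof. by move=> x y z; apply: (cs_mulA ax). Qed.
Fact uc_mul1r : left_id (uc_one U) (@cs_mul R (uc_alg U)).
Proof. by move=> x; have [] := uc_oneP (u := U) x. Qed.
Fact uc_mulr1 : right_id (uc_one U) (@cs_mul R (uc_alg U)).
Proof. by move=> x; have [] := uc_oneP (u := U) x. Qed.
Fact uc_mulrDl : left_distributive (@cs_mul R (uc_alg U)) +%R.
Proof. by move=> x y z; apply: (cs_mulDl ax). Qed.
Fact uc_mulrDr : right_distributive (@cs_mul R (uc_alg U)) +%R.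
Proof. by move=> x y z; apply: (cs_mulDr ax). Qed.
HB.instance Definition _ := GRing.Zmodule_isNzRing.Build (ucar U)
  uc_mulrA uc_mul1r uc_mulr1 uc_mulrDl uc_mulrDr (uc_one_neq0 U).

Fact uc_scalerAl (a : R[i]) (x y : ucar U) : a *: (x * y) = a *: x * y.
Proof. by rewrite /GRing.mul /= (cs_mulZl ax). Qed.
HB.instance Definition _ := GRing.Lmodule_isLalgebra.Build R[i] (ucar U) uc_scalerAl.
Fact uc_scalerAr (a : R[i]) (x y : ucar U) : a *: (x * y) = x * (a *: y).
Proof. by rewrite /GRing.mul /= (cs_mulZr ax). Qed.
HB.instance Definition _ := GRing.Lalgebra_isAlgebra.Build R[i] (ucar U) uc_scalerAr.
End RingStructure.

Definition star (R : realType) (U : ucstar R) (x : U) : U := @cs_star R (uc_alg U) x.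
Definition nrm (R : realType) (U : ucstar R) (x : U) : R := @cs_norm R (uc_alg U) x.

Definition rsc (R : realType) (U : ucstar R) (t : R) : U := (t%:C)%:A.
Notation "t %:U" := (rsc _ t) (at level 2, left associativity, format "t %:U").

Lemma cconjE (R : realType) (z : R[i]) : cconj z = Num.conj z.
Proof. by case: z. Qed.

Fact cconj_additive (R : realType) : additive (@cconj R).
Proof. by move=> x y; rewrite !cconjE rmorphB. Qed.
Fact cconj_multiplicative (R : realType) : multiplicative (@cconj R).
Proof. by split=> [x y|]; rewrite !cconjE ?rmorphM ?rmorph1. Qed.
HB.instance Definition _ (R : realType) :=
  GRing.isAdditive.Build R[i] R[i] (@cconj R) (@cconj_additive R).
HB.instance Definition _ (R : realType) :=
  GRing.isMultiplicative.Build R[i] R[i] (@cconj R) (@cconj_multiplicative R).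

Lemma cconjK (R : realType) : involutive (@cconj R).
Proof. by move=> z; rewrite !cconjE conjCK. Qed.

Lemma cconj_real (R : realType) (t : R) : cconj t%:C = t%:C.
Proof. by rewrite /cconj /= oppr0. Qed.

Lemma cconj_ge0 (R : realType) (z : R[i]) : 0 <= z -> cconj z = z.
Proof. by move=> z0; rewrite cconjE; apply/CrealP; exact: ger0_real. Qed.

Lemma mul_cconj (R : realType) (z : R[i]) : z * cconj z = `|z| ^+ 2.
Proof. by rewrite cconjE normCK. Qed.

Lemma cabsE (R : realType) (z : R[i]) : (cabs z)%:C = `|z|.
Proof. by rewrite normc_def. Qed.

Lemma cabs_real (R : realType) (t : R) : cabs t%:C = `|t|.
Proof. by rewrite /cabs /= expr0n /= addr0 sqrtr_sqr. Qed.

Section Basics.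
Variables (R : realType) (U : ucstar R).
Implicit Types (x y z a b : U) (s t : R).
Let ax := cs_ax (uc_alg U).

Fact rsc_additive : additive (@rsc R U).
Proof. by move=> s t; rewrite /rsc rmorphB scalerBl. Qed.
Fact rsc_multiplicative : multiplicative (@rsc R U).
Proof. by split=> [s t|]; rewrite /rsc ?rmorphM ?rmorph1 ?scale1r // -scalerAl mul1r scalerA. Qed.
HB.instance Definition _ := GRing.isAdditive.Build R U (@rsc R U) rsc_additive.
HB.instance Definition _ := GRing.isMultiplicative.Build R U (@rsc R U) rsc_multiplicative.

Lemma rsc1 : (1 : R)%:U = 1 :> U. Proof. exact: rmorph1. Qed.
Lemma rsc0 : (0 : R)%:U = 0 :> U. Proof. exact: rmorph0. Qed.
Lemma rscD s t : (s + t)%:U = s%:U + t%:U :> U. Proof. exact: rmorphD. Qed.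
Lemma rscN t : (- t)%:U = - t%:U :> U. Proof. exact: rmorphN. Qed.
Lemma rscB s t : (s - t)%:U = s%:U - t%:U :> U. Proof. exact: rmorphB. Qed.
Lemma rscM s t : (s * t)%:U = s%:U * t%:U :> U. Proof. exact: rmorphM. Qed.
Lemma rscC t x : t%:U * x = x * t%:U.
Proof. by rewrite /rsc -scalerAl -scalerAr mul1r mulr1. Qed.
Lemma rscE t x : t%:C *: x = t%:U * x.
Proof. by rewrite /rsc -scalerAl mul1r. Qed.
Lemma rscA t x y : x * (t%:U * y) = t%:U * (x * y).
Proof. by rewrite mulrA -rscC mulrA. Qed.

Lemma starK x : star (star x) = x. Proof. exact: (cs_starK ax). Qed.
Lemma starD x y : star (x + y) = star x + star y. Proof. exact: (cs_starD ax). Qed.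
Lemma starZ (c : R[i]) x : star (c *: x) = cconj c *: star x.
Proof. exact: (cs_starZ ax). Qed.
Lemma starM x y : star (x * y) = star y * star x. Proof. exact: (cs_starM ax). Qed.
Lemma star0 : star 0 = 0 :> U. Proof. by apply: (addIr (star 0)); rewrite -starD !add0r. Qed.
Lemma starN x : star (- x) = - star x.
Proof. by apply: (addIr (star x)); rewrite -starD !addNr star0. Qed.
Lemma starB x y : star (x - y) = star x - star y. Proof. by rewrite starD starN. Qed.
Lemma star1 : star 1 = 1 :> U.
Proof. by rewrite -[LHS]mulr1 -{2}[1]starK -starM mulr1 starK. Qed.
Lemma star_rsc t : star t%:U = t%:U :> U.
Proof. by rewrite /rsc starZ star1 cconj_real. Qed.

Lemma nrmD x y : nrm (x + y) <= nrm x + nrm y. Proof. exact: (cs_nrm_triangle ax). Qed.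
Lemma nrmM x y : nrm (x * y) <= nrm x * nrm y. Proof. exact: (cs_nrmM ax). Qed.
Lemma nrmZ (c : R[i]) x : nrm (c *: x) = cabs c * nrm x. Proof. exact: (cs_nrmZ ax). Qed.
Lemma nrm_starM x : nrm (star x * x) = nrm x ^+ 2. Proof. exact: (cs_cstar_id ax). Qed.
Lemma nrm_eq0 x : nrm x = 0 -> x = 0. Proof. exact: (cs_nrm_eq0 ax). Qed.
Lemma nrm_rscM t x : nrm (t%:U * x) = `|t| * nrm x.
Proof. by rewrite -rscE nrmZ cabs_real. Qed.
Lemma nrm0 : nrm (0 : U) = 0.
Proof. by rewrite -[0](scale0r (0 : U)) nrmZ -[0]/(0%:C) cabs_real normr0 mul0r. Qed.
Lemma nrmN x : nrm (- x) = nrm x.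
Proof. by rewrite -mulN1r -rsc1 -rscN nrm_rscM normrN1 mul1r. Qed.
Lemma nrm_ge0 x : 0 <= nrm x.
Proof. have := nrmD x (- x); rewrite subrr nrm0 nrmN; lra. Qed.
Lemma nrmB x y : nrm (x - y) = nrm (y - x). Proof. by rewrite -nrmN opprB. Qed.
Lemma nrm_star x : nrm (star x) = nrm x.
Proof.
have half y : nrm y <= nrm (star y).
  have [->|ny] := eqVneq (nrm y) 0; first exact: nrm_ge0.
  have y0 : 0 < nrm y by rewrite lt_def ny nrm_ge0.
  by have := nrmM (star y) y; rewrite nrm_starM expr2 ler_pM2r.
by apply/eqP; rewrite eq_le half andbT -{2}[x]starK half.
Qed.
Lemma nrm1 : nrm (1 : U) = 1.
Proof.
have := nrm_starM 1; rewrite star1 mulr1 expr2 => h.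
have [/nrm_eq0/eqP|n1] := eqVneq (nrm (1 : U)) 0; first by rewrite oner_eq0.
by apply: (mulfI n1); rewrite -h mulr1.
Qed.
Lemma nrm_rsc t : nrm (t%:U : U) = `|t|.
Proof. by rewrite -[rsc U t]mulr1 nrm_rscM nrm1 mulr1. Qed.
Lemma nrmBD x y z : nrm (x - z) <= nrm (x - y) + nrm (y - z).
Proof. by have := nrmD (x - y) (y - z); rewrite addrA subrK. Qed.

(** * Limits *)

Definition lim_to (u : nat -> U) (l : U) : Prop :=
  forall eps : R, 0 < eps -> exists N, forall n, (N <= n)%N -> nrm (u n - l) < eps.

Lemma lim_cst x : lim_to (fun=> x) x.
Proof. by move=> e e0; exists 0%N => n _; rewrite subrr nrm0. Qed.

Lemma lim_unique u x y : lim_to u x -> lim_to u y -> x = y.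
Proof.
move=> ux uy; apply/eqP; rewrite -subr_eq0; apply/eqP/nrm_eq0/eqP; apply: contraT => n0.
suff: nrm (x - y) < nrm (x - y) by rewrite ltxx.
have d0 : 0 < nrm (x - y) / 2 by rewrite divr_gt0 // lt_def n0 nrm_ge0.
have [M hM] := ux _ d0; have [N hN] := uy _ d0.
have := hM _ (leq_maxl M N); have := hN _ (leq_maxr M N).
have := nrmBD x (u (maxn M N)) y; rewrite (nrmB x (u _)); lra.
Qed.

Lemma lim_shift u x : lim_to u x -> lim_to (fun n => u n.+1) x.
Proof. by move=> ux e /ux[N hN]; exists N => n Nn; apply/hN/leqW. Qed.

Lemma limD u v x y : lim_to u x -> lim_to v y -> lim_to (fun n => u n + v n) (x + y).
Proof.
move=> ux vy e e0; have e20 : 0 < e / 2 by lra.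
have [M hM] := ux _ e20; have [N hN] := vy _ e20.
exists (maxn M N) => n; rewrite geq_max => /andP[Mn Nn].
have := hM _ Mn; have := hN _ Nn; have := nrmD (u n - x) (v n - y).
rewrite opprD addrACA; lra.
Qed.

Lemma limM u v x y : lim_to u x -> lim_to v y -> lim_to (fun n => u n * v n) (x * y).
Proof.
move=> ux vy e e0.
have x0 := nrm_ge0 x; have y0 := nrm_ge0 y.
(* Errors [p], [q] of norm below [d <= 1] make [p * q + p * y + x * q] of norm below [d * K]. *)
pose K := 1 + nrm x + nrm y; have K0 : 0 < K by rewrite /K; lra.
pose d := Num.min 1 (e / K).
have d0 : 0 < d by rewrite lt_min ltr01 divr_gt0.
have d1 : d <= 1 by rewrite ge_min lexx.
have dK : d * K <= e by rewrite -ler_pdivlMr // ge_min lexx orbT.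
have [M hM] := ux _ d0; have [N hN] := vy _ d0.
exists (maxn M N) => n; rewrite geq_max => /andP[Mn Nn].
have := hM _ Mn; have := hN _ Nn.
set p := u n - x; set q := v n - y => hq hp.
have -> : u n * v n - x * y = p * q + p * y + x * q.
  by rewrite -[u n](subrK x) -[v n](subrK y) -/p -/q mulrDl !mulrDr !addrA addrK.
have hpq := nrmM p q; have hpy := nrmM p y; have hxq := nrmM x q.
have t1 := nrmD (p * q + p * y) (x * q); have t2 := nrmD (p * q) (p * y).
have p0 := nrm_ge0 p; have q0 := nrm_ge0 q.
apply: lt_le_trans dK; rewrite /K.
nra.
Qed.

Lemma lim_star u x : lim_to u x -> lim_to (fun n => star (u n)) (star x).
Proof. by move=> ux e /ux[N hN]; exists N => n /hN; rewrite -starB nrm_star. Qed.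

Lemma lim_nrm_le u x t : lim_to u x -> (forall n, nrm (u n) <= t) -> nrm x <= t.
Proof.
move=> ux ut; apply/ler_addgt0Pr => e /ux[N /(_ N (leqnn N))].
have := ut N; have := nrmD (x - u N) (u N); rewrite subrK nrmB; lra.
Qed.

(** The hypotheses force [t] to be nondecreasing; being bounded, it is Cauchy, and it passes this on
    to [u]. No geometric rate is asked for, since the real majorant of the square root iteration
    converges too slowly to supply one. *)
Lemma cauchy_dominated (u : nat -> U) (t : nat -> R) T :
  (forall n, t n <= T) -> (forall n, nrm (u n.+1 - u n) <= t n.+1 - t n) ->
  exists l, lim_to u l.
Proof.
move=> tT ut.
have inc m n : (n <= m)%N -> nrm (u m - u n) <= t m - t n.
  elim: m => [|m IH]; first by rewrite leqn0 => /eqP->; rewrite !subrr nrm0.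
  rewrite leq_eqVlt => /orP[/eqP->|]; first by rewrite !subrr nrm0.
  by rewrite ltnS => /IH; have := ut m; have := nrmBD (u m.+1) (u m) (u n); lra.
pose S := [set t n | n in [set: nat]]%classic.
have hS : has_sup S.
  by split; [exists (t 0%N); exists 0%N | exists T => _ [n _ <-]].
apply: (cs_complete ax) => e e0.
have [_ [N _ <-] hN] := sup_adherent e0 hS.
exists N => m n Nm Nn.
have key i j : (j <= i)%N -> (N <= j)%N -> nrm (u i - u j) < e.
  move=> ji Nj; apply: le_lt_trans (inc _ _ ji) _.
  have : t i <= sup S by apply: ub_le_sup; [exists T => _ [k _ <-]|exists i].
  have : t N <= t j by have := inc _ _ Nj; have := nrm_ge0 (u j - u N); lra.
  lra.
by case: (leqP n m) => [/key|/ltnW/key] h; [exact: h | have := h Nm; rewrite nrmB].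
Qed.

End Basics.
(** * Positive elements *)

Section Positivity.
Variables (R : realType) (U : ucstar R).
Implicit Types (x y z a b : U) (s t : R).

(* For [t >= 0] and self-adjoint [a], [nrm (t - a) <= t] says that the spectrum
   of [a] lies in [[0, 2 t]]; stated this way the cone property is immediate. *)
Definition Pos a := star a = a /\ exists t, nrm (t%:U - a) <= t.

Lemma Pos_sa a : Pos a -> star a = a. Proof. by case. Qed.

Lemma PosD a b : Pos a -> Pos b -> Pos (a + b).
Proof.
move=> [sa [s hs]] [sb [t ht]]; split; first by rewrite starD sa sb.
exists (s + t); have := nrmD (s%:U - a) (t%:U - b).
by rewrite rscD opprD addrACA; lra.
Qed.

Lemma Pos_rscM t a : 0 <= t -> Pos a -> Pos (t%:U * a).
Proof.
move=> t0 [sa [s hs]]; split; first by rewrite starM sa star_rsc rscC.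
by exists (t * s); rewrite rscM -mulrBr nrm_rscM ger0_norm // ler_wpM2l.
Qed.

Lemma Pos_rsc t : 0 <= t -> Pos (t%:U).
Proof. by move=> t0; split; [exact: star_rsc | exists t; rewrite subrr nrm0]. Qed.

Lemma Pos0 : Pos 0. Proof. by rewrite -(rsc0 U); exact: Pos_rsc. Qed.
Lemma Pos1 : Pos 1. Proof. by rewrite -(rsc1 U); exact: Pos_rsc. Qed.

Lemma Pos_nrmB a : star a = a -> Pos ((nrm a)%:U - a).
Proof. by move=> sa; split; [rewrite starB star_rsc sa|exists (nrm a); rewrite opprB addrCA subrr addr0]. Qed.

Lemma Pos_nrmD a : star a = a -> Pos ((nrm a)%:U + a).
Proof. by move=> sa; rewrite -nrmN -{2}[a]opprK; apply: Pos_nrmB; rewrite starN sa. Qed.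

Lemma mul_half a : (2^-1)%:U * (a + a) = a.
Proof.
rewrite mulrDr -mulrDl -rscD.
have -> : 2^-1 + 2^-1 = 1 :> R by lra.
by rewrite rsc1 mul1r.
Qed.

(* Iterate [y |-> (1 - b + y^2) / 2], whose limit is [1 - sqrt b];
   its increments are dominated by those of the same iteration for [b = 0] in [R]. *)
Lemma sqrt_near1 b : star b = b -> nrm (1 - b) <= 1 ->
  exists s : U, [/\ star s = s, nrm (1 - s) <= 1, s * s = b &
    forall z, z * b = b * z -> z * s = s * z].
Proof.
move=> sb hb; pose c : U := 1 - b.
pose h : U := (2^-1 : R)%:U.
have [y y0 eY] : exists2 y : nat -> U, y 0%N = 0 & forall n, y n.+1 = h * (c + y n * y n).
  by exists (fix y (n : nat) : U := if n is m.+1 then h * (c + y m * y m) else 0).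
have [t t0 eT] : exists2 t : nat -> R, t 0%N = 0 & forall n, t n.+1 = 2^-1 * (1 + t n * t n).
  by exists (fix t (n : nat) : R := if n is m.+1 then 2^-1 * (1 + t m * t m) else 0).
have tP n : 0 <= t n <= 1 by elim: n => [|n IH]; rewrite ?t0 ?eT; [lra|nra].
have tS (n : nat) : t n <= t n.+1.
  elim: n => [|n IH]; first by rewrite eT t0; lra.
  by rewrite [leLHS]eT [leRHS]eT; have := tP n; have := tP n.+1; nra.
have hn x : nrm (h * x) = 2^-1 * nrm x by rewrite nrm_rscM ger0_norm //; lra.
have yt n : nrm (y n) <= t n.
  elim: n => [|n IH]; first by rewrite y0 t0 nrm0.
  rewrite eY eT hn; have := nrmD c (y n * y n); have := nrmM (y n) (y n).
  have := nrm_ge0 (y n); rewrite -/c in hb; have := tP n; nra.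
have cy z n : z * c = c * z -> z * y n = y n * z.
  move=> zc; elim: n => [|n IH]; first by rewrite y0 mulr0 mul0r.
  rewrite eY rscA -[RHS]mulrA; congr (_ * _).
  by rewrite mulrDr mulrDl zc mulrA IH -!mulrA IH.
have yy m n : y m * y n = y n * y m by apply: (cy); symmetry; apply: cy.
have dy n : nrm (y n.+1 - y n) <= t n.+1 - t n.
  elim: n => [|n IH].
    rewrite eY eT y0 t0 !mulr0 !addr0 !subr0 hn mulr1; rewrite -/c in hb; lra.
  have -> : y n.+2 - y n.+1 = h * ((y n.+1 - y n) * (y n.+1 + y n)).
    rewrite (eY n.+1) {3}(eY n) -mulrBr; congr (_ * _).
    rewrite opprD addrACA subrr add0r mulrBl !mulrDr (yy n n.+1) opprD.
    by rewrite addrA addrK.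
  rewrite hn; have -> : t n.+2 - t n.+1 = 2^-1 * ((t n.+1 - t n) * (t n.+1 + t n)).
    by rewrite (eT n.+1) {3}(eT n); ring.
  apply: ler_wpM2l; first by lra.
  apply: le_trans (nrmM _ _) _; apply: ler_pM; rewrite ?nrm_ge0 //.
  by have := nrmD (y n.+1) (y n); have := yt n; have := yt n.+1; lra.
have [l ly] := cauchy_dominated (fun n => (andP (tP n)).2) dy.
have el : l = h * (c + l * l).
  apply: lim_unique (lim_shift ly) _.
  rewrite (_ : (fun n => _) = fun n => h * (c + y n * y n)); last exact: funext.
  exact: limM (lim_cst _) (limD (lim_cst _) (limM ly ly)).
have sl : star l = l.
  apply: lim_unique (lim_star ly) _.
  suff -> : (fun n => star (y n)) = y by [].
  apply: funext; elim=> [|n IH]; first by rewrite y0 star0.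
  by rewrite eY starM star_rsc -rscC starD starM IH starB star1 sb.
exists (1 - l); split.
- by rewrite starB star1 sl.
- rewrite opprB addrCA subrr addr0; apply: lim_nrm_le ly _ => n.
  by apply: le_trans (yt n) _; case/andP: (tP n).
- have : l + l = c + l * l.
    by rewrite {1 2}el -mulrDr mul_half.
  move=> e; have ec : c = l + l - l * l by rewrite e addrK.
  by rewrite mulrBl mul1r mulrBr mulr1 -[b](subKr 1) -/c ec !opprD !addrA.
- move=> z zb; rewrite mulrBl mulrBr mulr1 mul1r; congr (_ - _).
  have zc : z * c = c * z by rewrite mulrBl mulrBr mulr1 mul1r zb.
  apply: lim_unique (limM (lim_cst z) ly) _.
  suff -> : (fun n => z * y n) = (fun n => y n * z) by exact: limM ly (lim_cst z).
  by apply: funext => n; apply: cy.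
Qed.

(** Dividing by the [t] that witnesses positivity reduces to [sqrt_near1]. The commutation clause is
    the substitute for functional calculus: roots of commuting elements commute. *)
Lemma sqrt_exists a : Pos a -> exists s : U, [/\ Pos s, s * s = a &
    forall z, z * a = a * z -> z * s = s * z].
Proof.
move=> [sa [t ht]].
have t0 : 0 <= t by apply: le_trans ht; exact: nrm_ge0.
have [tz|tn] := eqVneq t 0.
  exists 0; split; [exact: Pos0| |by move=> z _; rewrite mulr0 mul0r].
  apply/eqP; rewrite mulr0 -subr_eq0; apply/eqP/nrm_eq0.
  by apply/eqP; rewrite eq_le nrm_ge0 andbT; move: ht; rewrite tz rsc0.
have tV : t^-1 * t = 1 by rewrite mulVf.
have [||s [ss s1 es cs]] := @sqrt_near1 (t^-1%:U * a).
- by rewrite starM sa star_rsc rscC.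
- rewrite -(rsc1 U) -tV rscM -mulrBr nrm_rscM ger0_norm ?invr_ge0 //.
  by rewrite ler_pdivrMl ?tV ?mulr1 // lt_def tn t0.
exists ((Num.sqrt t)%:U * s); split.
- apply: Pos_rscM; first exact: sqrtr_ge0.
  by split=> //; exists 1; rewrite rsc1.
- rewrite -mulrA rscA es mulrA -rscM -expr2 sqr_sqrtr // mulrA -rscM.
  by rewrite divff // rsc1 mul1r.
- move=> z za; rewrite rscA -mulrA; congr (_ * _); apply: cs.
  by rewrite rscA -mulrA za.
Qed.

End Positivity.

(** * Decomposition into self-adjoint parts *)

Section Cartesian.
Variables (R : realType) (U : ucstar R).
Implicit Types (x y z a b : U) (s t : R).

Definition re x : U := (2^-1)%:U * (x + star x).
Definition im x : U := re (- 'i *: x).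

Lemma re_sa x : star (re x) = re x.
Proof. by rewrite /re starM star_rsc -rscC starD starK addrC. Qed.
Lemma im_sa x : star (im x) = im x. Proof. exact: re_sa. Qed.

Lemma star_i x : star ('i *: x) = - ('i *: star x).
Proof. by rewrite starZ -scaleNr; congr (_ *: _); apply/eqP; rewrite eq_complex /= oppr0 !eqxx. Qed.

Lemma scale_ii x : 'i *: ('i *: x) = - x.
Proof. by rewrite scalerA -expr2 sqr_i scaleN1r. Qed.

Lemma re_im x : x = re x + 'i *: im x.
Proof.
rewrite /im /re scaleNr starN star_i opprK scalerAr scalerDr scalerN !scale_ii opprK.
by rewrite -mulrDr addrACA subrr addr0 mul_half.
Qed.

Lemma star_re_im x : star x = re x - 'i *: im x.
Proof. by rewrite {1}(re_im x) starD star_i re_sa im_sa. Qed.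

Lemma mul_cartesian x y :
  (x - 'i *: y) * (x + 'i *: y) = x * x + y * y + 'i *: (x * y - y * x).
Proof.
rewrite mulrBl !mulrDr -!scalerAl -!scalerAr scale_ii scalerBr opprD opprK.
by rewrite addrACA [RHS]addrAC -!addrA; congr (_ + _); rewrite addrC -!addrA;
   congr (_ + _); rewrite addrC.
Qed.

(** Used to show that [x * star x] is positive once [- (star x * x)] is, the sum of the two products
    being a sum of squares of self-adjoint elements. *)
Lemma mul_star_cartesian x :
  star x * x + x * star x = (re x * re x + im x * im x) + (re x * re x + im x * im x).
Proof.
move: (re x) (im x) (re_im x) (star_re_im x) => u v ex es; rewrite es ex.
have := mul_cartesian u (- v); rewrite scalerN opprK => ->.
rewrite mul_cartesian mulrNN mulrN mulNr opprK addrACA -scalerDr.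
by rewrite [X in 'i *: X]addrACA subrr addNr addr0 scaler0 addr0.
Qed.

End Cartesian.

(** * Order, norm and the positivity of [star x * x] *)

Section Positivity2.
Variables (R : realType) (U : ucstar R).
Implicit Types (x y z a b : U) (s t : R).

(** The element [u = x + 'i *: y] satisfies [star u * u = t], and [x] is half of [u + star u]. This
    is the source of the norm bounds that spectral theory would give. *)
Lemma nrm_le_of_sq_sum x y t : star x = x -> star y = y -> x * y = y * x ->
  x * x + y * y = t%:U -> nrm x ^+ 2 <= `|t|.
Proof.
move=> sx sy xy e; pose u := x + 'i *: y.
have su : star u = x - 'i *: y by rewrite starD star_i sx sy.
have nu : nrm u ^+ 2 = `|t|.
  by rewrite -nrm_starM su mul_cartesian e xy subrr scaler0 addr0 nrm_rsc.
rewrite -nu; apply: lerXn2r; rewrite ?nnegrE ?nrm_ge0 //.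
have -> : x = (2^-1)%:U * (u + star u) by rewrite su addrACA subrr addr0 mul_half.
by rewrite nrm_rscM ger0_norm; [have := nrmD u (star u); rewrite nrm_star; lra|lra].
Qed.

(** Let [t] be the norm of [x * x] and [k] a square root of [t - x * x]; it commutes with [x] and
    the two squares sum to [t], so [nrm (k * k) <= t], which is the bound that [Pos] asks for. *)
Lemma Pos_sq x : star x = x -> Pos (x * x).
Proof.
move=> sx; split; first by rewrite starM sx.
pose t := nrm (x * x); exists t; pose b := t%:U - x * x.
have Pb : Pos b by apply: Pos_nrmB; rewrite starM sx.
have [k [Pk kk ck]] := sqrt_exists Pb.
have xk : k * x = x * k.
  by symmetry; apply: ck; rewrite mulrBr mulrBl rscC mulrA.
rewrite -/b -kk.
have := nrm_le_of_sq_sum (Pos_sa Pk) sx xk.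
rewrite kk subrK => /(_ _ erefl); rewrite ger0_norm ?nrm_ge0 // -kk.
by rewrite -{2}(Pos_sa Pk) nrm_starM.
Qed.

Lemma PosM a b : Pos a -> Pos b -> a * b = b * a -> Pos (a * b).
Proof.
move=> Pa Pb ab.
have [s [Ps ss cs]] := sqrt_exists Pa; have [r [Pr rr cr]] := sqrt_exists Pb.
have sr : s * r = r * s by apply: cr; rewrite cs.
have -> : a * b = (s * r) * (s * r).
  by rewrite -ss -rr -!mulrA; congr (_ * _); rewrite !mulrA sr.
by apply: Pos_sq; rewrite starM !Pos_sa.
Qed.

Lemma Pos_rsc_ge0 t : Pos (t%:U : U) -> 0 <= t.
Proof.
by move=> [_ [s]]; rewrite -rscB nrm_rsc ler_norml => /andP[_]; lra.
Qed.

Lemma nrm_le_Pos a t : Pos a -> Pos (t%:U - a) -> nrm a <= t.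
Proof.
move=> Pa Pb; have t0 : 0 <= t.
  by apply: Pos_rsc_ge0; rewrite -(subrK a t%:U); apply: PosD.
have [s [Ps ss cs]] := sqrt_exists Pa; have [r [Pr rr cr]] := sqrt_exists Pb.
have sr : s * r = r * s.
  apply: cr; rewrite mulrBr mulrBl rscC; congr (_ - _).
  by rewrite -ss mulrA.
have := nrm_le_of_sq_sum (Pos_sa Ps) (Pos_sa Pr) sr.
rewrite ss rr addrC subrK => /(_ _ erefl); rewrite ger0_norm //.
by rewrite -nrm_starM (Pos_sa Ps) ss.
Qed.

Lemma nrm_le_sandwich a t : star a = a -> Pos (t%:U - a) -> Pos (t%:U + a) -> nrm a <= t.
Proof.
move=> sa P1 P2; have t0 : 0 <= t.
  have := PosD P1 P2; rewrite addrCA subrK -rscD => /Pos_rsc_ge0; lra.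
rewrite -(@ler_pXn2r _ 2) ?nnegrE ?nrm_ge0 // -nrm_starM sa.
apply: nrm_le_Pos; first exact: Pos_sq.
have cm : t%:U * a = a * t%:U by exact: rscC.
have -> : (t ^+ 2)%:U - a * a = (t%:U - a) * (t%:U + a).
  by rewrite mulrBl !mulrDr cm expr2 rscM opprD addrA addrK.
by apply: PosM => //; rewrite mulrBl mulrDl !mulrBr !mulrDr cm opprD !addrA addrK subrK.
Qed.

(** With [m] the square root of [a * a], take half of [m + a] and of [m - a]. Cubes are what comes
    cheaply: since [p * m = p * p], the cube of [p] is the product of the commuting positive
    elements [p * p] and [m]. They suffice wherever a positive part is used. *)
Lemma Pos_parts a : star a = a -> exists p q : U,
  [/\ [/\ star p = p, star q = q, p * q = 0 & q * p = 0], a = p - q, Pos (p + q),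
      Pos (p * p * p) /\ Pos (q * q * q) &
      forall z, z * a = a * z -> z * p = p * z /\ z * q = q * z].
Proof.
move=> sa; have [m [Pm mm cm]] := sqrt_exists (Pos_sq sa).
have am : a * m = m * a by apply: cm; rewrite mulrA.
pose h : U := (2^-1)%:U.
pose p := h * (m + a); pose q := h * (m - a).
have sp : star p = p by rewrite starM starD star_rsc -rscC (Pos_sa Pm) sa.
have sq : star q = q by rewrite starM starB star_rsc -rscC (Pos_sa Pm) sa.
have epq : p + q = m by rewrite -mulrDr addrACA subrr addr0 mul_half.
have emq : p - q = a by rewrite -mulrBr opprB addrC addrA subrK mul_half.
have pq : p * q = 0.
  rewrite /p /q -mulrA (rscA _ (m + a)) mulrDl !mulrBr mm am.
  by rewrite addrA subrK subrr !mulr0.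
have qp : q * p = 0 by rewrite -[RHS]star0 -pq starM sp sq.
have hPos : forall u, star u = u -> u * m = u * u -> m * u = u * u -> Pos (u * u * u).
  move=> u su um mu; rewrite -mulrA -[X in u * X]um mulrA.
  by apply: PosM => //; [exact: Pos_sq | rewrite [RHS]mulrA mu -!mulrA um].
exists p, q; split=> //; first by rewrite epq.
- split; apply: hPos => //; rewrite -epq ?(mulrDr, mulrDl) ?pq ?qp ?addr0 ?add0r //.
- move=> z za; have zm : z * m = m * z by apply: cm; rewrite mulrA za -mulrA za mulrA.
  have hz : z * h = h * z by rewrite rscC.
  by split; rewrite mulrA hz -!mulrA; congr (_ * _);
     rewrite mulrDr mulrDl ?mulrN ?mulNr zm za.
Qed.

(* Kelley-Vaught.  With [y = x^* x = p - q] and [z = x q] one has [z^* z = - q^3],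
   whereas [w = z z^*] turns out to be positive; comparing the norms of the two
   sides of [(N - w) z = z (N + q^3)], [N = nrm (q^3)], forces [N = 0]. *)
Theorem Pos_starM x : Pos (star x * x).
Proof.
pose y := star x * x; have sy : star y = y by rewrite starM starK.
have [p [q [[sp sq pq qp] ey Ppq [_ Pe] _]]] := Pos_parts sy.
pose e := q * q * q; pose z := x * q; pose w := z * star z; pose N := nrm e.
have se : star e = e by exact: Pos_sa.
have zz : star z * z = - e.
  rewrite starM sq -mulrA [star x * _]mulrA -/y ey mulrBl pq sub0r mulrN.
  by rewrite /e -mulrA.
have Pw : Pos w.
  have -> : w = star z * z + w + e by rewrite zz addrAC addNr add0r.
  rewrite mul_star_cartesian.
  by do !apply: PosD => //; apply: Pos_sq; [exact: re_sa|exact: im_sa|exact: re_sa|exact: im_sa].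
have Nz : nrm z ^+ 2 = N by rewrite -nrm_starM zz nrmN.
have Nw : nrm w = N by rewrite -Nz -(nrm_star z) -nrm_starM starK.
have N0 : 0 <= N by exact: nrm_ge0.
have hNw : nrm (N%:U - w) <= N.
  apply: nrm_le_sandwich; first by rewrite starB star_rsc Pos_sa.
    by rewrite opprB addrCA subrr addr0.
  by apply: PosD; [exact: Pos_rsc | rewrite -Nw; apply: Pos_nrmB; rewrite Pos_sa].
pose f := N%:U + e; have sf : star f = f by rewrite starD star_rsc se.
have fe : f * e = e * f by rewrite mulrDl mulrDr rscC.
have e1 : (N%:U - w) * z = z * f.
  by rewrite mulrBl -mulrA zz mulrN opprK rscC mulrDr.
have e2 : nrm (f * e * f) <= N ^+ 3.
  have -> : f * e * f = - (star (z * f) * (z * f)).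
    by rewrite starM sf -[in RHS]mulrA [star z * _]mulrA zz mulNr mulrN opprK mulrA.
  rewrite nrmN nrm_starM -e1 (exprS N 2) -{2}Nz.
  have h := nrmM (N%:U - w) z; have z0 := nrm_ge0 z; have d0 := nrm_ge0 ((N%:U - w) * z).
  have h2 : nrm ((N%:U - w) * z) <= N * nrm z by nra.
  have : nrm ((N%:U - w) * z) ^+ 2 <= (N * nrm z) ^+ 2 by rewrite lerXn2r ?nnegrE ?mulr_ge0.
  by rewrite exprMn expr2; nra.
(* Expanding, [f * e * f] is [N^2 e + 2 N e^2 + e^3], which dominates [2 N e^2], of norm [2 N^3].
   Against the bound [N^3] of [e2] this leaves only [N = 0]. *)
have e3 : 2 * N * nrm (e * e) <= nrm (f * e * f).
  have -> : 2 * N * nrm (e * e) = nrm ((2 * N)%:U * (e * e)).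
    by rewrite nrm_rscM ger0_norm // mulr_ge0.
  apply: nrm_le_Pos; first by apply: Pos_rscM; [rewrite mulr_ge0|exact: Pos_sq].
  have sF : star (f * e * f) = f * e * f by rewrite starM (starM f e) sf se mulrA.
  have -> : (nrm (f * e * f))%:U - (2 * N)%:U * (e * e) =
     ((nrm (f * e * f))%:U - f * e * f) + ((N * N)%:U * e + e * (e * e)).
    rewrite -addrA; congr (_ + _).
    have -> : f * e * f = (N * N)%:U * e + (2 * N)%:U * (e * e) + e * (e * e).
      have -> : 2 * N = N + N by ring.
      rewrite /f mulrDl mulrDr !mulrDl -(rscC N (_ * e)) -(rscC N (e * e)) rscM rscD mulrDl.
      by rewrite -!mulrA -!addrA.
    by rewrite addrAC opprD addrAC addNr add0r.
  apply: PosD; first exact: Pos_nrmB.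
  apply: PosD; first by apply: Pos_rscM; [exact: mulr_ge0|].
  by apply: PosM => //; [exact: Pos_sq|rewrite mulrA].
have Nee : nrm (e * e) = N ^+ 2 by rewrite -{1}se nrm_starM.
have N00 : N = 0.
  apply/eqP; rewrite eq_le N0 andbT leNgt; apply/negP => Npos.
  have : 0 < N ^+ 3 by rewrite exprn_gt0.
  by move: e2 e3; rewrite Nee (exprS N 2); nra.
have q0 : q = 0.
  have : nrm q ^+ 2 ^+ 2 = 0.
    rewrite -nrm_starM sq -nrm_starM starM sq.
    by rewrite !mulrA -/e (nrm_eq0 N00) mul0r nrm0.
  by move/eqP; rewrite !expf_eq0 /= => /eqP/nrm_eq0.
by move: Ppq; rewrite -/y ey q0 addr0 subr0.
Qed.

Lemma Pos_conj a x : Pos a -> Pos (star x * a * x).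
Proof.
move=> /sqrt_exists[s [Ps ss _]].
have -> : star x * a * x = star (s * x) * (s * x).
  by rewrite starM (Pos_sa Ps) -ss !mulrA.
exact: Pos_starM.
Qed.

Lemma Pos_nrm2B x : Pos ((nrm x ^+ 2)%:U - star x * x).
Proof. by rewrite -nrm_starM; apply: Pos_nrmB; rewrite starM starK. Qed.

End Positivity2.
(** * Positive semidefinite forms *)

Definition psd_form (R : realType) (V : lmodType R[i]) (q : V -> V -> R[i]) : Prop :=
  [/\ forall x y z, q x (y + z) = q x y + q x z,
      forall (c : R[i]) x y, q x (c *: y) = c * q x y,
      forall x y, q y x = cconj (q x y)
    & forall x, 0 <= q x x].

Section Forms.
Variables (R : realType) (V : lmodType R[i]) (q : V -> V -> R[i]).
Hypothesis Hq : psd_form q.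

Lemma formDr x y z : q x (y + z) = q x y + q x z. Proof. by case: Hq. Qed.
Lemma formZr c x y : q x (c *: y) = c * q x y. Proof. by case: Hq. Qed.
Lemma formC x y : q y x = cconj (q x y). Proof. by case: Hq. Qed.
Lemma form_ge0 x : 0 <= q x x. Proof. by case: Hq. Qed.
Lemma formDl x y z : q (x + y) z = q x z + q y z.
Proof. by rewrite formC formDr rmorphD /= -!formC. Qed.
Lemma formZl c x y : q (c *: x) y = cconj c * q x y.
Proof. by rewrite formC formZr rmorphM /= -formC. Qed.

Lemma form_expand c x y :
  q (x + c *: y) (x + c *: y) = q x x + (c * q x y + cconj (c * q x y)) + c * cconj c * q y y.
Proof.
rewrite formDr !formDl !formZr !formZl rmorphM /= -(formC x y) !addrA mulrA.
by rewrite [in LHS](addrAC (q x x)).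
Qed.

Lemma form_null x y : q y y = 0 -> q x y = 0.
Proof.
move=> y0; apply/eqP; apply: contraT => nz.
have m0 : 0 < `|q x y| ^+ 2 by rewrite exprn_gt0 // normr_gt0.
(* Moving [x] along [y] by [- k * cconj (q x y)] changes the diagonal value to
   [q x x - 2 (q x x + 1)], which is negative. *)
pose k := (q x x + 1) / `|q x y| ^+ 2.
have k0 : 0 <= k by rewrite divr_ge0 ?addr_ge0 ?form_ge0 ?ler01 // ltW.
have := form_ge0 (x + (- k * cconj (q x y)) *: y).
have kr : cconj k = k by exact: cconj_ge0.
rewrite form_expand y0 mulr0 addr0 -mulrA [cconj _ * _]mulrC.
have -> : q x y * cconj (q x y) = `|q x y| ^+ 2 by exact: mul_cconj.
rewrite mulNr divfK ?gt_eqF // rmorphN rmorphD rmorph1 /= -formC => h.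
have /addr_ge0/(_ h) := form_ge0 x.
rewrite (_ : _ + _ = - 2); last by ring.
by rewrite oppr_ge0 lern0.
Qed.

End Forms.

Record linform (R : realType) (V : lmodType R[i]) := LinForm {
  lf_fun :> V -> R[i];
  lfD : forall x y, lf_fun (x + y) = lf_fun x + lf_fun y;
  lfZ : forall (c : R[i]) x, lf_fun (c *: x) = c * lf_fun x }.

Section LinForm.
Variables (R : realType) (V : lmodType R[i]).
Implicit Types l : linform V.

Lemma lf0 l : l 0 = 0. Proof. by rewrite -(scale0r (0 : V)) lfZ mul0r. Qed.
Lemma lfN l x : l (- x) = - l x. Proof. by rewrite -scaleN1r lfZ mulN1r. Qed.
Lemma lfB l x y : l (x - y) = l x - l y. Proof. by rewrite lfD lfN. Qed.

Definition lf_zero : linform V.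
Proof. by exists (fun=> 0) => *; rewrite ?addr0 ?mulr0. Defined.

(* One Gram-Schmidt step, performed on forms instead of vectors. *)
Lemma form_reduce (q : V -> V -> R[i]) y : psd_form q -> q y y != 0 ->
  exists l : linform V,
    psd_form (fun u v => q u v - cconj (l u) * l v) /\ q y y = cconj (l y) * l y.
Proof.
move=> Hq d0; pose d := q y y; pose s := sqrtC d.
have dpos : 0 < d by rewrite lt_def d0 form_ge0.
have ss : s * s = d by rewrite -expr2 sqrtCK.
have s0 : s != 0 by apply: contraNneq d0 => e; rewrite -/d -ss e mulr0.
have sr : cconj s = s by apply: cconj_ge0; rewrite sqrtC_ge0 ltW.
have lD u v : q y (u + v) / s = q y u / s + q y v / s by rewrite formDr // mulrDl.
have lZ c u : q y (c *: u) / s = c * (q y u / s) by rewrite formZr // mulrA.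
have [l lE] : exists l : linform V, forall u, l u = q y u / s by exists (LinForm lD lZ).
exists l.
have ll u v : cconj (l u) * l v = q u y * q y v / d.
  rewrite !lE rmorphM fmorphV /= sr -(formC Hq) -ss invfM.
  by rewrite mulrACA.
split; last by rewrite ll -/d mulfK // gt_eqF.
split.
- by move=> u v w; rewrite (lfD l) formDr // mulrDr opprD addrACA.
- by move=> c u v; rewrite (lfZ l) formZr // mulrCA mulrBr.
- by move=> u v; rewrite [RHS]rmorphB (rmorphM _ (cconj (l u))) /= cconjK -(formC Hq) mulrC.
- move=> u; rewrite ll.
  have := form_ge0 Hq (u + (- (q y u / d)) *: y); rewrite form_expand //.
  have dr : cconj d = d by rewrite -(formC Hq).
  rewrite !rmorphM !rmorphN !rmorphM !fmorphV /= dr -!(formC Hq) -/d.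
  suff -> : q u u + (- (q y u / d) * q u y + - (q u y / d) * q y u) +
    - (q y u / d) * - (q u y / d) * d = q u u - q u y * q y u / d by [].
  by field; rewrite gt_eqF.
Qed.

(** Each vector of [ys] costs at most one rank-one subtraction. The remaining form stays positive
    semidefinite and vanishes on the diagonal at [ys], so [form_null] kills it as soon as one
    argument is in [ys]; the other argument stays arbitrary. *)
Lemma gram_factor (q : V -> V -> R[i]) (ys : seq V) : psd_form q ->
  exists L : seq (linform V), forall u v, v \in ys ->
    q u v = \sum_(l <- L) cconj (l u) * l v.
Proof.
move=> Hq; suff [L [HL L0]] : exists L : seq (linform V),
  psd_form (fun u v => q u v - \sum_(l <- L) cconj (l u) * l v) /\
  forall v, v \in ys -> q v v = \sum_(l <- L) cconj (l v) * l v.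
  exists L => u v vin; apply/eqP; rewrite -subr_eq0; apply/eqP.
  by apply: (form_null HL); rewrite (L0 v vin) subrr.
elim: ys => [|y ys [L [HL L0]]].
  exists [::]; split=> //.
  have -> : (fun u v => q u v - \sum_(l <- [::] : seq (linform V)) cconj (l u) * l v) = q.
    by apply: funext => u; apply: funext => v; rewrite big_nil subr0.
  exact: Hq.
have [e|ne] := eqVneq (q y y - \sum_(l <- L) cconj (l y) * l y) 0.
  exists L; split=> // v; rewrite inE => /orP[/eqP->|]; last exact: L0.
  by apply/eqP; rewrite -subr_eq0 e.
have [l [Hl el]] := form_reduce HL ne.
have eqL : (fun u v => q u v - \sum_(l0 <- l :: L) cconj (l0 u) * l0 v) =
   (fun u v => q u v - (\sum_(l0 <- L) cconj (l0 u) * l0 v) - cconj (l u) * l v).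
  apply: funext => u; apply: funext => v.
  by rewrite big_cons opprD addrA addrAC.
exists (l :: L); split; first by rewrite eqL.
move=> v; rewrite inE big_cons => /orP[/eqP->|vin].
  by rewrite -el subrK.
(* At an older vector the previous remainder is already zero, so positivity of the new one reads
   [0 <= - |l v|^2] and [l v] vanishes. *)
have := form_ge0 Hl v; rewrite (L0 v vin) subrr sub0r oppr_ge0.
rewrite mulrC mul_cconj => h.
have /eqP : `|l v| ^+ 2 = 0 by apply/le_anti; rewrite h exprn_ge0.
by rewrite expf_eq0 normr_eq0 /= => /eqP->; rewrite normr0 expr0n add0r.
Qed.

End LinForm.
(** * States *)

Section Cones.
Variables (R : realType) (U : ucstar R).
Implicit Types (x y z a b f : U) (s t : R) (K N : U -> Prop).

Definition central c := forall x, c * x = x * c.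

Lemma central_rsc t : central t%:U. Proof. by move=> x; rewrite rscC. Qed.

Lemma centralD b c : central b -> central c -> central (b + c).
Proof. by move=> cb cc x; rewrite mulrDl mulrDr cb cc. Qed.
Lemma centralM b c : central b -> central c -> central (b * c).
Proof. by move=> cb cc x; rewrite -mulrA cc mulrA cb mulrA. Qed.
Lemma centralZ (d : R[i]) c : central c -> central (d *: c).
Proof. by move=> cc x; rewrite -scalerAl -scalerAr cc. Qed.
Lemma central_star c : central c -> central (star c).
Proof. by move=> cc x; rewrite -[x]starK -!starM cc. Qed.

(** Two instances matter: nonnegative scalars, for which maximal cones are total, and positive
    central elements, for which they yield multiplicativity on the center. *)
Definition multipliers K : Prop :=
  [/\ forall t, 0 <= t -> K t%:U, forall k, K k -> Pos k /\ central k,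
      forall k k', K k -> K k' -> K (k + k') & forall k k', K k -> K k' -> K (k * k')].

Definition proper_cone K N : Prop :=
  [/\ forall a, N a -> star a = a, forall a, Pos a -> N a,
      forall a b, N a -> N b -> N (a + b), forall k a, K k -> N a -> N (k * a)
    & ~ N (-1)].

Lemma multipliers_real : multipliers (fun k => exists2 t, 0 <= t & k = t%:U).
Proof.
split=> [t t0|k [t t0 ->]|k k' [s s0 ->] [t t0 ->]|k k' [s s0 ->] [t t0 ->]].
- by exists t.
- by split; [exact: Pos_rsc|exact: central_rsc].
- by exists (s + t); rewrite ?addr_ge0 // rscD.
- by exists (s * t); rewrite ?mulr_ge0 // rscM.
Qed.

Lemma multipliers_central : multipliers (fun k => Pos k /\ central k).
Proof.
split=> [t t0|//|k k' [Pk ck] [Pk' ck']|k k' [Pk ck] [Pk' ck']].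
- by split; [exact: Pos_rsc|exact: central_rsc].
- by split; [exact: PosD|move=> x; rewrite mulrDl mulrDr ck ck'].
- by split; [apply: PosM|move=> x; rewrite -mulrA ck' mulrA ck mulrA].
Qed.

Lemma cone_max K N0 : multipliers K -> proper_cone K N0 ->
  exists N, [/\ proper_cone K N, forall a, N0 a -> N a &
    forall f, star f = f -> ~ N f -> exists n k, [/\ N n, K k & n + k * f = -1]].
Proof.
move=> [Kr Kc KD KM] HN0.
(* Zorn is applied to [X] with [N0] adjoined, rather than to cones containing [N0], so that the
   union of the empty chain is admissible too. *)
pose P (X : set U) := proper_cone K (fun a => X a \/ N0 a).
have [|A [PA maxA]] := @Zorn_bigcup U P.
  move=> F FP Ftot.
  have pair a b : (\bigcup_(X in F) X)%classic a \/ N0 a ->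
      (\bigcup_(X in F) X)%classic b \/ N0 b ->
      exists M : U -> Prop, [/\ proper_cone K M, M a, M b &
        forall c, M c -> (\bigcup_(X in F) X)%classic c \/ N0 c].
    have sub X : F X -> forall c, X c \/ N0 c -> (\bigcup_(X in F) X)%classic c \/ N0 c.
      by move=> FX c [Xc|]; [left; exists X|right].
    move=> [[X FX Xa]|Na] [[Y FY Yb]|Nb].
    - have [XY|YX] := Ftot _ _ FX FY.
      + by exists (fun c => Y c \/ N0 c); split; [exact: FP|left; exact: XY|left|exact: sub].
      + by exists (fun c => X c \/ N0 c); split; [exact: FP|left|left; exact: YX|exact: sub].
    - by exists (fun c => X c \/ N0 c); split; [exact: FP|left|right|exact: sub].
    - by exists (fun c => Y c \/ N0 c); split; [exact: FP|right|left|exact: sub].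
    - by exists N0; split=> // c; right.
  split.
  - by move=> a Fa; have [M [[h _ _ _ _] Ma _ _]] := pair a a Fa Fa; exact: h.
  - by move=> a Pa; right; case: HN0 => _ h _ _ _; exact: h.
  - by move=> a b Fa Fb; have [M [[_ _ h _ _] Ma Mb]] := pair a b Fa Fb; apply; exact: h.
  - by move=> k a Kk Fa; have [M [[_ _ _ h _] Ma _]] := pair a a Fa Fa; apply; exact: h.
  - by move=> F1; have [M [[_ _ _ _ h] Ma _ _]] := pair _ _ F1 F1; exact: h.
pose N a := A a \/ N0 a; exists N; split=> //; first by right.
move=> f sf nNf; have [Nsa NP ND NM N1] := PA.
apply: contrapT => no.
(* The cone generated by [N] and [f]; if it missed [-1] it would be a proper cone strictly larger
   than [N]. *)
pose B a := exists n k, [/\ N n, K k & n + k * f = a].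
have AB a : N a -> B a.
  by move=> Na; exists a, (0%:U); rewrite rsc0 mul0r addr0; split=> //; rewrite -(rsc0 U); exact: Kr.
have Bf : B f.
  exists 0, (1%:U); rewrite rsc1 mul1r add0r; split=> //; first by apply: NP; exact: Pos0.
  by rewrite -(rsc1 U); apply: Kr.
apply: (maxA B).
  split; first by move=> a Aa; apply: AB; left.
  by move=> BA; apply: nNf; left; exact: BA.
have BN a : B a \/ N0 a -> B a by case=> // Na; apply: AB; right.
split.
- move=> a /BN[n [k [Nn Kk <-]]]; have [Pk ck] := Kc _ Kk.
  by rewrite starD (Nsa n Nn) starM sf (Pos_sa Pk) ck.
- by move=> a Pa; left; apply: AB; exact: NP.
- move=> a b /BN[n [k [Nn Kk <-]]] /BN[n' [k' [Nn' Kk' <-]]]; left.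
  exists (n + n'), (k + k'); split; [exact: ND|exact: KD|].
  by rewrite mulrDl addrACA.
- move=> k a Kk /BN[n [k' [Nn Kk' <-]]]; left.
  exists (k * n), (k * k'); split; [exact: NM|exact: KM|].
  by rewrite mulrDr mulrA.
- by move=> /BN[n [k [Nn Kk e]]]; apply: no; exists n, k.
Qed.

End Cones.

Section ReIm.
Variables (R : realType) (U : ucstar R).
Implicit Types (x y : U) (t : R).

Lemma star_rscM t x : star (t%:U * x) = t%:U * star x.
Proof. by rewrite starM star_rsc rscC. Qed.
Lemma reD x y : re (x + y) = re x + re y.
Proof. by rewrite /re starD addrACA mulrDr. Qed.
Lemma re_rscM t x : re (t%:U * x) = t%:U * re x.
Proof. by rewrite /re starM star_rsc -rscC -mulrDr rscA. Qed.
Lemma reN x : re (- x) = - re x.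
Proof. by rewrite /re starN -opprD mulrN. Qed.
Lemma imD x y : im (x + y) = im x + im y. Proof. by rewrite /im scalerDr reD. Qed.
Lemma imN x : im (- x) = - im x. Proof. by rewrite /im scalerN reN. Qed.
Lemma im_rscM t x : im (t%:U * x) = t%:U * im x.
Proof. by rewrite /im scalerAr re_rscM. Qed.
Lemma re_i x : re ('i *: x) = - im x. Proof. by rewrite /im scaleNr reN opprK. Qed.
Lemma im_i x : im ('i *: x) = re x. Proof. by rewrite /im scaleNr scale_ii opprK. Qed.
Lemma re_of_sa x : star x = x -> re x = x.
Proof. by move=> sx; rewrite /re sx mul_half. Qed.
Lemma im_of_sa x : star x = x -> im x = 0.
Proof. by move=> sx; rewrite /im /re starZ sx rmorphN /= -scalerDl (_ : - 'i + _ = 0) ?scale0r ?mulr0 //;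
  apply/eqP; rewrite eq_complex /= !oppr0 addr0 opprK addNr !eqxx. Qed.
Lemma scale_re_im (c : R[i]) x :
  c *: x = (complex.Re c)%:U * x + 'i *: ((complex.Im c)%:U * x).
Proof. by rewrite [in LHS](complexE c) scalerDl -scalerA !rscE. Qed.
Lemma re_star x : re (star x) = re x. Proof. by rewrite /re starK addrC. Qed.
Lemma im_star x : im (star x) = - im x.
Proof.
rewrite (star_re_im x) imD imN im_i im_of_sa; last exact: re_sa.
by rewrite sub0r re_of_sa // im_sa.
Qed.

End ReIm.

(** * The state determined by a total cone *)

Section TotalCone.
Variables (R : realType) (U : ucstar R) (N : U -> Prop).
Implicit Types (x y z a b f g : U) (s t : R).
Hypothesis HN : proper_cone (fun k => exists2 t, 0 <= t & k = t%:U) N.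
Hypothesis Ntot : forall f, star f = f -> N f \/ N (- f).

Let NP a : Pos a -> N a. Proof. by case: HN => _ h _ _ _; exact: h. Qed.
Let ND a b : N a -> N b -> N (a + b). Proof. by case: HN => _ _ h _ _; apply: h. Qed.
Let NM t a : 0 <= t -> N a -> N (t%:U * a).
Proof. by move=> t0; case: HN => _ _ _ h _; apply: h; exists t. Qed.

Let N_rsc t : N t%:U -> 0 <= t.
Proof.
move=> Nt; rewrite leNgt; apply/negP => t0; case: HN => _ _ _ _; apply.
have -> : -1 = (- t^-1)%:U * t%:U :> U by rewrite -rscM mulNr mulVf ?lt_eqF // rscN rsc1.
by apply: NM; rewrite ?oppr_ge0 ?invr_le0 ?ltW //.
Qed.

(** A Dedekind cut: [s] is the value at [f] of the state that is nonnegative on [N]. The slack [e]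
    is there because [N] need not be closed. *)
Definition cone_value f s := forall e, 0 < e -> N (f - (s - e)%:U) /\ N ((s + e)%:U - f).

Lemma cone_value_exists f : star f = f -> exists s, cone_value f s.
Proof.
move=> sf; pose S := [set t | N (f - t%:U)]%classic.
have lo : N (f - (- nrm f)%:U).
  by apply: NP; rewrite rscN opprK addrC; exact: Pos_nrmD.
have ub t : S t -> t <= nrm f.
  move=> St; rewrite -subr_ge0; apply: N_rsc.
  have := ND St (NP (Pos_nrmB sf)).
  by rewrite addrC rscB addrA subrK.
have hS : has_sup S by split; [exists (- nrm f)|exists (nrm f)].
exists (sup S) => e e0; split.
  have [t St ht] := sup_adherent e0 hS.
  have -> : f - (sup S - e)%:U = (f - t%:U) + (t - (sup S - e))%:U.
    by rewrite (rscB _ t) addrA subrK.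
  by apply: ND => //; apply: NP; apply: Pos_rsc; lra.
have [|Nf|] := @Ntot (f - (sup S + e)%:U); first by rewrite starB star_rsc sf.
  have : sup S + e <= sup S by apply: ub_le_sup; [exists (nrm f)|].
  lra.
by rewrite opprB.
Qed.

Lemma cone_value_le f g s t : cone_value f s -> cone_value g t -> N (g - f) -> s <= t.
Proof.
move=> Vf Vg Ngf; apply/ler_addgt0Pr => e e0.
have e20 : 0 < e / 2 by lra.
have [Nf _] := Vf _ e20; have [_ Ng] := Vg _ e20.
suff /N_rsc : N (t + e - s)%:U by lra.
have -> : (t + e - s)%:U = ((t + e / 2)%:U - g) + ((g - f) + (f - (s - e / 2)%:U)).
  by rewrite !addrA !subrK -rscB; congr (_%:U); lra.
by apply: ND => //; apply: ND.
Qed.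

Lemma cone_value_rsc t : cone_value t%:U t.
Proof. by move=> e e0; rewrite -!rscB; split; apply: NP; apply: Pos_rsc; lra. Qed.

Lemma cone_value_unique f s t : cone_value f s -> cone_value f t -> s = t.
Proof.
move=> Vs Vt; apply/eqP; rewrite eq_le !(@cone_value_le f f) // subrr; apply: NP; exact: Pos0.
Qed.

Lemma cone_value_ge0 f s : N f -> cone_value f s -> 0 <= s.
Proof.
by move=> Nf Vf; apply: (cone_value_le (cone_value_rsc 0) Vf); rewrite rsc0 subr0.
Qed.

Lemma cone_valueD f g s t : cone_value f s -> cone_value g t -> cone_value (f + g) (s + t).
Proof.
move=> Vf Vg e e0; have e20 : 0 < e / 2 by lra.
have [f1 f2] := Vf _ e20; have [g1 g2] := Vg _ e20.
split.
  rewrite (_ : _ - _ = (f - (s - e / 2)%:U) + (g - (t - e / 2)%:U)); first exact: ND.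
  by rewrite addrACA -opprD -rscD; congr (_ - _%:U); lra.
rewrite (_ : _ - _ = ((s + e / 2)%:U - f) + ((t + e / 2)%:U - g)); first exact: ND.
by rewrite addrACA -opprD -rscD; congr (_%:U - _); lra.
Qed.

Lemma cone_valueN f s : cone_value f s -> cone_value (- f) (- s).
Proof.
move=> Vf e /Vf[f1 f2]; split.
  rewrite (_ : _ - _ = (s + e)%:U - f) // -rscN addrC; congr (_%:U - _); ring.
rewrite (_ : _ - _ = f - (s - e)%:U) // opprK addrC -rscN; congr (_ + _%:U); ring.
Qed.

Lemma cone_valueZ f s t : cone_value f s -> cone_value (t%:U * f) (t * s).
Proof.
have pos r : 0 < r -> cone_value f s -> cone_value (r%:U * f) (r * s).
  move=> r0 Vf e e0; have [f1 f2] := Vf _ (divr_gt0 e0 r0).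
  have er : r * (e / r) = e by rewrite mulrC divfK // gt_eqF.
  split; [move: (NM (ltW r0) f1)|move: (NM (ltW r0) f2)];
    by rewrite mulrBr -rscM ?(mulrBr r) ?(mulrDr r) er.
move=> Vf; have [t0|t0|->] := ltgtP t 0; last first.
- by rewrite rsc0 !mul0r; move: (cone_value_rsc 0); rewrite rsc0.
- exact: pos.
- have := cone_valueN (pos (- t) _ Vf); rewrite rscN !mulNr !opprK; apply.
  by rewrite oppr_gt0.
Qed.

End TotalCone.

Record state (R : realType) (U : ucstar R) := State {
  st_fun :> linform U;
  st_star : forall x : U, st_fun (star x) = cconj (st_fun x);
  st_ge0 : forall a : U, Pos a -> 0 <= st_fun a;
  st1 : st_fun 1 = 1 }.

Lemma ge0_real_complex (R : realType) (z : R[i]) : 0 <= z -> exists2 r : R, 0 <= r & z = r%:C.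
Proof.
move=> z0; exists (complex.Re z); first by move: z0; rewrite lecE /= => /andP[].
by rewrite RRe_real // ger0_real.
Qed.

Lemma st_rsc (R : realType) (U : ucstar R) (phi : state U) t : phi t%:U = t%:C.
Proof. by rewrite /rsc lfZ st1 mulr1. Qed.

Section States.
Variables (R : realType) (U : ucstar R).
Implicit Types (x y z a b f c : U) (s t : R) (N : U -> Prop).

Lemma state_of_total_cone N :
  proper_cone (fun k => exists2 t, 0 <= t & k = t%:U) N ->
  (forall f, star f = f -> N f \/ N (- f)) ->
  exists phi : state U, forall f, star f = f ->
    exists2 s, phi f = s%:C & cone_value N f s.
Proof.
move=> HN Ntot.
have [L HL] : exists L : U -> R, forall f, star f = f -> cone_value N f (L f).
  have h f : exists s, star f = f -> cone_value N f s.
    have [sf|nsf] := pselect (star f = f); last by exists 0.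
    by have [s Vs] := cone_value_exists HN Ntot sf; exists s.
  by have [L HL] := choice h; exists L.
have LE f s : star f = f -> cone_value N f s -> L f = s.
  by move=> sf; apply: cone_value_unique => //; exact: HL.
pose phi x : R[i] := Complex (L (re x)) (L (im x)).
have phiD x y : phi (x + y) = phi x + phi y.
  rewrite /phi reD imD; congr Complex; apply: LE; rewrite ?starD ?re_sa ?im_sa //;
    by apply: cone_valueD => //; apply: HL; rewrite ?re_sa ?im_sa.
have phiZ (d : R[i]) x : phi (d *: x) = d * phi x.
  rewrite scale_re_im /phi reD imD re_i im_i !re_rscM !im_rscM; case: d => d1 d2 /=.
  rewrite [RHS]/GRing.mul /=; congr Complex; apply: LE;
    rewrite ?starB ?starD ?(star_rscM d1) ?(star_rscM d2) ?re_sa ?im_sa //.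
    apply: cone_valueD => //; first by apply: cone_valueZ => //; apply: HL; exact: re_sa.
    by apply: cone_valueN => //; apply: cone_valueZ => //; apply: HL; exact: im_sa.
  by apply: cone_valueD => //; apply: cone_valueZ => //; apply: HL; rewrite ?re_sa ?im_sa.
have phi_sa f : star f = f -> phi f = (L f)%:C.
  move=> sf; rewrite /phi re_of_sa // im_of_sa //; congr Complex.
  by apply: LE; rewrite ?star0 // -(rsc0 U); exact: cone_value_rsc.
have phi_star x : phi (star x) = cconj (phi x).
  rewrite /phi re_star im_star /cconj /=; congr Complex.
  by apply: LE; [rewrite starN im_sa|apply: cone_valueN => //; apply: HL; exact: im_sa].
have phi_ge0 a : Pos a -> 0 <= phi a.
  move=> Pa; have sa := Pos_sa Pa; rewrite phi_sa // ler0c.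
  by apply: (cone_value_ge0 HN _ (HL _ sa)); case: HN => _ h _ _ _; exact: h.
have phi1 : phi 1 = 1.
  rewrite phi_sa ?star1 // (_ : L 1 = 1) //; apply: LE; first exact: star1.
  by rewrite -(rsc1 U); exact: cone_value_rsc.
exists (@State R U (LinForm phiD phiZ) phi_star phi_ge0 phi1) => f sf.
by exists (L f); [exact: phi_sa|exact: HL].
Qed.

Lemma state_form (phi : state U) : psd_form (fun x y : U => phi (star x * y)).
Proof.
split=> [x y z|c x y|x y|x].
- by rewrite mulrDr lfD.
- by rewrite -scalerAr lfZ.
- by rewrite -st_star starM starK.
- exact/st_ge0/Pos_starM.
Qed.

Lemma state_null (phi : state U) x y : phi (star y * y) = 0 -> phi (star x * y) = 0.
Proof. exact: (form_null (state_form phi)). Qed.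

(** If neither sign is in [N], maximality gives [n1 + k1 f = -1] and [n2 - k2 f = -1].
    Cross-multiplying eliminates [f], everything being central, and yields
    [- k1 = k2 n1 + k1 n2 + k2] in [N]. As [T + f] is positive for [T = nrm f], also
    [-1 = T (- k1) + n1 + k1 (T + f)] lies in [N]. *)
Lemma proper_cone_total N f : proper_cone (fun k => Pos k /\ central k) N ->
  (forall g, star g = g -> ~ N g ->
     exists n k, [/\ N n, Pos k /\ central k & n + k * g = -1]) ->
  star f = f -> central f -> N f \/ N (- f).
Proof.
move=> [Nsa NP ND NM N1] maxN sf cf.
apply: contrapT => /not_orP[nf nf'].
have [n1 [k1 [Nn1 [P1 c1] e1]]] := maxN _ sf nf.
have [|n2 [k2 [Nn2 [P2 c2] e2]]] := maxN (- f) _ nf'; first by rewrite starN sf.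
have Nk : N (- k1).
  have -> : - k1 = (k2 * n1 + k1 * n2) + k2.
    have h1 : k2 * n1 = - k2 - k2 * (k1 * f).
      by rewrite -[n1](addrK (k1 * f)) e1 mulrBr mulrN1.
    have h2 : k1 * n2 = - k1 + k2 * (k1 * f).
      by rewrite -[n2](addrK (k2 * - f)) e2 mulrBr !mulrN mulr1 opprK !mulrA c1.
    by rewrite h1 h2 addrACA addNr addr0 addrAC addNr add0r.
  by apply: (ND); [apply: (ND); exact: NM|exact: NP].
apply: N1; pose T := nrm f; have T0 : 0 <= T by exact: nrm_ge0.
have -> : -1 = (T%:U * (- k1)) + (n1 + k1 * (T%:U + f)).
  by rewrite mulrN rscC mulrDr [X in n1 + X]addrC [X in _ + X]addrA e1 addrCA addNr addr0.
apply: (ND); first by apply: (NM) => //; split; [exact: Pos_rsc|exact: central_rsc].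
by apply: ND => //; apply: NM => //; apply: NP; exact: Pos_nrmD.
Qed.

(** Two maximal extensions are needed. The first, under central multipliers, decides central
    elements but perhaps no others; the second, under scalars, is total and defines [phi], which
    stays nonnegative on the first cone. A central self-adjoint [c] with [phi c = 0] is then
    infinitesimal for the first cone, whence [phi (c * c) = 0], and Cauchy-Schwarz gives
    [phi (c * y) = 0]. *)
Theorem state_exists N0 : proper_cone (fun k => Pos k /\ central k) N0 ->
  exists phi : state U, (forall a, N0 a -> 0 <= phi a) /\
    forall c y, central c -> phi (c * y) = phi c * phi y.
Proof.
move=> HN0; have [N [HN N0N maxN]] := cone_max (multipliers_central U) HN0.
have [Nsa NP ND NM N1] := HN.
have HN' : proper_cone (fun k => exists2 t, 0 <= t & k = t%:U) N.
  split=> // k a [t t0 ->] Na; apply: NM => //.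
  by split; [exact: Pos_rsc|exact: central_rsc].
have [M [HM NM' maxM]] := cone_max (multipliers_real U) HN'.
have Mtot f : star f = f -> M f \/ M (- f).
  move=> sf; have [|nf] := pselect (M f); [by left|right].
  have [n [_ [Mn [t t0 ->] e]]] := maxM _ sf nf.
  have [_ MP MD MM M1] := HM.
  have tn : t != 0 by apply: contra_notN M1 => /eqP tz; rewrite -e tz rsc0 mul0r addr0.
  have -> : - f = t^-1%:U * (1 + n).
    rewrite -[1]opprK -e opprD addrAC addNr add0r mulrN mulrA -rscM mulVf //.
    by rewrite rsc1 mul1r.
  apply: MM; first by exists t^-1; rewrite ?invr_ge0.
  by apply: MD => //; apply: MP; exact: Pos1.
have [phi Hphi] := state_of_total_cone HM Mtot.
have phi_ge0 a : N a -> 0 <= phi a.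
  move=> Na; have [s -> Vs] := Hphi _ (Nsa _ Na); rewrite ler0c.
  by apply: (cone_value_ge0 HM _ Vs); exact: NM'.
exists phi; split; first by move=> a /N0N; exact: phi_ge0.
(* Here [p] is the positive part of [c]. Multiplying [e - c] by the central positive cube of [p]
   gives [phi (p^4) <= e phi (p^3)] for all [e], so [phi (p^4) = 0]; Cauchy-Schwarz against [1]
   brings this down to [p^2]. *)
have half_null p c : central p -> star p = p -> Pos (p * p * p) -> p * c = p * p ->
    (forall e, 0 < e -> N (e%:U - c)) -> phi (p * p) = 0.
  move=> cp sp P3 pc small.
  have P4 : Pos ((p * p) * (p * p)) by apply: Pos_sq; rewrite starM sp.
  have key e : 0 < e -> phi ((p * p) * (p * p)) <= e%:C * phi (p * p * p).
    move=> e0; rewrite -subr_ge0 -lfZ -lfB; apply: phi_ge0.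
    have -> : e%:C *: (p * p * p) - p * p * (p * p) = p * p * p * (e%:U - c).
      by rewrite mulrBr rscE rscC -!mulrA pc.
    by apply: (NM) (small _ e0); split=> //; do !apply: centralM.
  have /ge0_real_complex[a a0 ea] := phi_ge0 _ (NP _ P3).
  have /ge0_real_complex[b b0 eb] := phi_ge0 _ (NP _ P4).
  have b00 : b = 0.
    apply/eqP; rewrite eq_le b0 andbT; apply/ler_addgt0Pr => e e0; rewrite add0r.
    have a1 : 0 < a + 1 by lra.
    have := key _ (divr_gt0 e0 a1); rewrite ea eb -rmorphM lecR => h; apply: le_trans h _.
    by rewrite mulrAC ler_pdivrMr // ler_pM2l //; lra.
  have := @state_null phi 1 (p * p); rewrite star1 mul1r starM sp; apply.
  by rewrite eb b00.
have null (c : U) : star c = c -> central c -> phi c = 0 -> phi (c * c) = 0.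
  move=> sc cc c0.
  have small e : 0 < e -> N (e%:U - c) /\ N (e%:U - - c).
    move=> e0.
    (* The cone decides the sign of [e - g], and the negative sign would force [- e >= 0] under
       [phi]. *)
    have tot g : star g = g -> central g -> phi g = 0 -> N (e%:U - g).
      move=> sg cg g0; have [||//|] := @proper_cone_total N (e%:U - g) HN maxN.
      - by rewrite starB star_rsc sg.
      - by move=> x; rewrite mulrBl mulrBr cg rscC.
      - move/phi_ge0; rewrite opprB lfB g0 sub0r st_rsc oppr_ge0 lecR; lra.
    split; apply: tot => //; rewrite ?starN ?sc ?lfN ?c0 ?oppr0 //.
    by move=> x; rewrite mulNr mulrN cc.
  have [p [q [[sp sq pq qp] ec _ [Pp Pq] cpq]]] := Pos_parts sc.
  have cp : central p by move=> x; have [-> _] := cpq x (esym (cc x)).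
  have cq : central q by move=> x; have [_ ->] := cpq x (esym (cc x)).
  have -> : c * c = p * p + q * q.
    by rewrite ec mulrBl !mulrBr pq qp subr0 sub0r opprK.
  rewrite lfD (half_null p c) // ?(half_null q (- c)) ?addr0 //.
  - by rewrite ec opprB mulrBr qp subr0.
  - by move=> e /small[].
  - by rewrite ec mulrBr pq subr0.
  - by move=> e /small[].
have mult_sa c y : star c = c -> central c -> phi (c * y) = phi c * phi y.
  move=> sc cc; have [s es _] := Hphi _ sc.
  have d0 : phi (c - s%:U) = 0 by rewrite lfB st_rsc es subrr.
  have sd : star (c - s%:U) = c - s%:U by rewrite starB sc star_rsc.
  have cd : central (c - s%:U) by move=> x; rewrite mulrBl mulrBr cc rscC.
  have := @state_null phi (star y) (c - s%:U).
  rewrite starK -(cd y) sd => /(_ (null _ sd cd d0)) /eqP.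
  by rewrite mulrBl lfB subr_eq0 -rscE lfZ es => /eqP.
move=> c y cc.
have cre b : central b -> central (re b).
  by move=> cb; apply: centralM; [exact: central_rsc|apply: centralD => //; exact: central_star].
have cr := cre _ cc; have ci : central (im c) by apply/cre/centralZ.
rewrite (re_im c) mulrDl -scalerAl !lfD !lfZ (mult_sa (re c)) ?(mult_sa (im c)) ?re_sa ?im_sa //.
by rewrite mulrDl mulrA.
Qed.

End States.
(** * Partitions of unity in commutative C*-algebras *)

Section Commutative.
Variables (R : realType) (A : ucstar R).
Hypothesis mulC : forall x y : A, x * y = y * x.
Implicit Types (a b p y : A).

(** Neumann series: [1 + p = T (1 - c)] with [T = 1 + nrm p] and [nrm c <= rho < 1]. The majorant
    series sums to [1 / (1 - rho) = T], hence the bound on [t]. Positivity of the inverse follows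
    from [r = r * r * (1 + p)]. *)
Lemma inverse_one_add p : Pos p -> exists2 r : A, Pos r & r * (1 + p) = 1.
Proof.
move=> Pp; have sp := Pos_sa Pp; pose n := nrm p; have n0 : 0 <= n := nrm_ge0 p.
pose T := 1 + n; have T0 : 0 < T by rewrite /T; lra.
have TV : T^-1 * T = 1 by rewrite mulVf // gt_eqF.
pose c : A := T^-1%:U * (n%:U - p); pose rho := T^-1 * n.
have rho0 : 0 <= rho by rewrite mulr_ge0 ?invr_ge0 // ltW.
have rhoT : 1 + rho * T = T by rewrite /rho mulrAC TV mul1r.
have nc : nrm c <= rho.
  rewrite nrm_rscM ger0_norm ?invr_ge0 ?(ltW T0) // ler_pM2l ?invr_gt0 //.
  by apply: nrm_le_Pos; [exact: Pos_nrmB | rewrite opprB addrCA subrr addr0].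
have [y y0 eY] : exists2 y : nat -> A, y 0%N = 0 & forall n, y n.+1 = 1 + c * y n.
  by exists (fix y (n : nat) : A := if n is m.+1 then 1 + c * y m else 0).
have [t t0 eT] : exists2 t : nat -> R, t 0%N = 0 & forall n, t n.+1 = 1 + rho * t n.
  by exists (fix t (n : nat) : R := if n is m.+1 then 1 + rho * t m else 0).
have tT k : t k <= T.
  elim: k => [|k IH]; first by rewrite t0 ltW.
  by rewrite eT -[leRHS]rhoT lerD2l ler_wpM2l.
have dy k : nrm (y k.+1 - y k) <= t k.+1 - t k.
  elim: k => [|k IH].
    by rewrite eY eT y0 t0 !mulr0 !addr0 !subr0 nrm1.
  have -> : y k.+2 - y k.+1 = c * (y k.+1 - y k).
    by rewrite (eY k.+1) {2}(eY k) opprD addrACA subrr add0r mulrBr.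
  have -> : t k.+2 - t k.+1 = rho * (t k.+1 - t k).
    by rewrite (eT k.+1) {2}(eT k); ring.
  by apply: le_trans (nrmM _ _) _; apply: ler_pM; rewrite ?nrm_ge0.
have [l ly] := cauchy_dominated tT dy.
have el : l = 1 + c * l.
  apply: lim_unique (lim_shift ly) _.
  rewrite (_ : (fun n => _) = fun n => 1 + c * y n); last exact: funext.
  exact: limD (lim_cst _) (limM (lim_cst _) ly).
pose r := T^-1%:U * l.
have rp : r * (1 + p) = 1.
  rewrite /r -mulrA (mulC l) mulrA.
  have -> : T^-1%:U * (1 + p) = 1 - c.
    rewrite /c -[X in X - _](rsc1 A) -TV rscM -mulrBr; congr (_ * _).
    by rewrite opprB addrCA /T rscD rsc1 addrK addrC.
  by rewrite mulrBl mul1r {1}el addrK.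
have sr : star r = r.
  have e : star r * (1 + p) = 1 by rewrite mulC -[1 + p](_ : star (1 + p) = _) -?starM ?rp ?star1 // starD star1 sp.
  by rewrite -[LHS]mulr1 -rp (mulC r) mulrA e mul1r.
exists r => //.
have -> : r = (r * r) * (1 + p) by rewrite -mulrA rp mulr1.
by apply: PosM; [exact: Pos_sq | apply: PosD => //; exact: Pos1 |exact: mulC].
Qed.

Variable I : A -> Prop.
Hypothesis I0 : I 0.
Hypothesis ID : forall a b, I a -> I b -> I (a + b).
Hypothesis IM : forall a b, I b -> I (a * b).
Hypothesis Istar : forall a, I a -> I (star a).

(** These are the points of the spectrum of the quotient of [A] by [I]. *)
Definition character (x : state A) : Prop :=
  (forall a b, x (a * b) = x a * x b) /\ forall a, I a -> x a = 0.

Variables (as_ : seq A) (eps : R).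
Hypothesis eps0 : 0 < eps.

Definition sqdev (x : state A) a : A := star (a - (x a)%:A) * (a - (x a)%:A).

(* The bump [g] is supported where the letters are [eps]-close to their values at [x]. *)
Definition bump (t : state A * A) : Prop :=
  [/\ character t.1, Pos t.2 & forall a, a \in as_ -> Pos (t.2 * (eps%:U - sqdev t.1 a))].

(** The sum [d] of the deviations treats all letters at once. As [x d = 0], the positive part [p] of
    [eps - d] has [x p != 0]: otherwise [x (p + q)] would be [- eps]. The bump is the cube of
    [p]. *)
Lemma bump_exists (x : state A) : character x -> exists2 u : A, bump (x, u) & x u != 0.
Proof.
move=> cx; pose d := \sum_(a <- as_) sqdev x a.
have Psum (s : seq A) : Pos (\sum_(a <- s) sqdev x a).
  by elim/big_ind: _ => [|b c|a _]; [exact: Pos0|exact: PosD|exact: Pos_starM].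
have Prest (s : seq A) a : a \in s -> Pos (\sum_(b <- s) sqdev x b - sqdev x a).
  elim: s => // b s IH; rewrite inE big_cons => /orP[/eqP->|/IH h].
    by rewrite addrAC subrr add0r.
  by rewrite -addrA; apply: PosD => //; exact: Pos_starM.
have xd : x d = 0.
  rewrite /d; elim: (as_) => [|a s IH]; first by rewrite big_nil lf0.
  rewrite big_cons lfD IH addr0 /sqdev cx.1 (_ : x (a - _) = 0) ?mulr0 //.
  by rewrite lfB lfZ st1 mulr1 subrr.
have sed : star (eps%:U - d) = eps%:U - d.
  by rewrite starB star_rsc (Pos_sa (Psum as_)).
have [p [q [[sp sq pq qp] ef Ppq [Pp _] _]]] := Pos_parts sed.
exists (p * p * p).
  split=> //= a ain.
  (* Against [p^3] the first summand leaves [p^4]; the second is a sum of the other deviations,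
     hence positive. *)
  have -> : eps%:U - sqdev x a = (p - q) + (d - sqdev x a) by rewrite -ef addrA subrK.
  rewrite mulrDr; apply: PosD.
    rewrite mulrBr -!mulrA pq !mulr0 subr0 !mulrA -mulrA.
    by apply: Pos_sq; rewrite starM sp.
  by apply: PosM => //; exact: Prest.
rewrite !cx.1 !mulf_neq0 //.
all: have e : x p - x q = eps%:C by rewrite -lfB -ef lfB xd st_rsc subr0.
all: apply: contraTneq (st_ge0 x Ppq) => xp0; rewrite lfD xp0 add0r.
all: have -> : x q = - eps%:C by rewrite -e xp0 sub0r opprK.
all: by rewrite oppr_ge0 lecR -ltNge.
Qed.

(** A cone argument replaces compactness of the spectrum. Let [N0] consist of the self-adjoint
    elements that are positive minus a finite sum of bumps, modulo [I]. If [-1] is in [N0], some sum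
    of bumps is [1 + p] modulo [I], and multiplying by the inverse of [1 + p] normalizes it.
    Otherwise [N0] is proper and carries a state; all of [A] being central, it is multiplicative,
    and it kills [I]. But minus its own bump lies in [N0], which contradicts [x u > 0]. *)
Theorem partition_of_unity : exists2 L : seq (state A * A),
  List.Forall bump L & I (1 - \sum_(t <- L) t.2).
Proof.
pose N0 a := star a = a /\ exists p L i,
  [/\ Pos p, List.Forall bump L, I i & a = p - \sum_(t <- L) t.2 - i].
have scale r L : Pos r -> List.Forall bump L -> exists2 L', List.Forall bump L' &
    \sum_(t <- L') t.2 = r * \sum_(t <- L) t.2.
  move=> Pr HL; exists [seq (t.1, r * t.2) | t <- L].
    elim: HL => [|[x g] L1 [/= cx Pg hg] _ IH] /=; constructor=> //.
    split=> //= [|a ain]; first exact: PosM.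
    by rewrite -mulrA; apply: PosM => //; exact: hg.
  by rewrite big_map /= mulr_sumr.
have [N1|N1] := pselect (N0 (-1)).
  have [_ [p [L [i [Pp HL Ii e]]]]] := N1.
  have [r Pr rp] := inverse_one_add Pp.
  have [L' HL' e'] := scale r L Pr HL; exists L' => //.
  have -> : 1 - \sum_(t <- L') t.2 = r * i; last exact: IM.
  rewrite e' -[in LHS]rp -mulrBr; congr (_ * _).
  by rewrite -[RHS](subKr (p - \sum_(t <- L) t.2)) -e opprK [RHS]addrC addrA.
have HN0 : proper_cone (fun k => Pos k /\ central k) N0.
  split=> //.
  - by move=> a [].
  - move=> a Pa; split; first exact: Pos_sa.
    by exists a, [::], 0; split=> //; rewrite big_nil !subr0.
  - move=> a b [sa [p [L [i [Pp HL Ii ea]]]]] [sb [q [M [j [Pq HM Ij eb]]]]].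
    split; first by rewrite starD sa sb.
    exists (p + q), (L ++ M), (i + j); split; [exact: PosD| |exact: ID|].
      exact/List.Forall_app.
    by rewrite big_cat /= ea eb addrACA (addrACA p) -!opprD.
  - move=> k a [Pk ck] [sa [p [L [i [Pp HL Ii ea]]]]].
    split; first by rewrite starM sa (Pos_sa Pk).
    have [L' HL' e'] := scale k L Pk HL.
    exists (k * p), L', (k * i); split; [exact: PosM|by []|exact: IM|].
    by rewrite ea e' !mulrBr.
have [x [x0 xM]] := state_exists HN0.
have cx : character x.
  split=> [a b|]; first by apply: xM => y; exact: mulC.
  have xI i : star i = i -> I i -> x i = 0.
    move=> si Ii; apply/le_anti; rewrite -oppr_ge0 -lfN !x0 //.
      split=> //; exists 0, [::], (- i); split; [exact: Pos0|by constructor| |].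
        by rewrite -mulN1r; exact: IM.
      by rewrite big_nil !sub0r oppr0 add0r opprK.
    split; first by rewrite starN si.
    exists 0, [::], i; split; [exact: Pos0|by constructor|by []|].
    by rewrite big_nil subr0 sub0r.
  have Ire i : I i -> I (re i) by move=> Ii; apply: IM; apply: ID => //; exact: Istar.
  move=> i Ii; rewrite (re_im i) lfD lfZ !xI ?mulr0 ?addr0 //; [exact: im_sa| |exact: re_sa|exact: Ire].
  by apply: Ire; rewrite -(mul1r i) scalerAl; exact: IM.
have [u bu xu] := bump_exists cx.
have [_ /= Pu _] := bu.
exfalso; move/eqP: xu; apply; apply/le_anti; rewrite (st_ge0 x Pu) andbT -oppr_ge0 -lfN x0 //.
split; first by rewrite starN (Pos_sa Pu).
exists 0, [:: (x, u)], 0; split; [exact: Pos0|by constructor; [|constructor]|exact: I0|].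
by rewrite big_seq1 subr0 sub0r.
Qed.

End Commutative.
(** * Matrix algebras *)

Section Cauchy.
Variable R : realType.
Implicit Types (z : R[i]) (t : R).

Lemma cabs_ge0 z : 0 <= cabs z. Proof. exact: sqrtr_ge0. Qed.
Lemma cabsM z z' : cabs (z * z') = cabs z * cabs z'.
Proof. by apply: complexI; rewrite rmorphM /= !cabsE normrM. Qed.
Lemma cabsD z z' : cabs (z + z') <= cabs z + cabs z'.
Proof. by rewrite -lecR rmorphD /= !cabsE ler_normD. Qed.
Lemma cabs_eq0 z : cabs z = 0 -> z = 0.
Proof. by move=> e; apply/eqP; rewrite -normr_eq0 -cabsE e. Qed.
Lemma cconjMl z : cconj z * z = (cabs z ^+ 2)%:C.
Proof. by rewrite mulrC mul_cconj -cabsE rmorphXn. Qed.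
Lemma Re_le_cabs z : `|complex.Re z| <= cabs z.
Proof. by rewrite -sqrtr_sqr ler_sqrt ?lerDl ?addr_ge0 ?sqr_ge0. Qed.
Lemma Im_le_cabs z : `|complex.Im z| <= cabs z.
Proof. by rewrite -sqrtr_sqr ler_sqrt ?lerDr ?addr_ge0 ?sqr_ge0. Qed.
Lemma cabs_le z : cabs z <= `|complex.Re z| + `|complex.Im z|.
Proof.
have e : z = (complex.Re z)%:C + 'i * (complex.Im z)%:C by exact: complexE.
rewrite {1}e; apply: le_trans (cabsD _ _) _; rewrite cabsM !cabs_real.
by rewrite (_ : cabs 'i = 1) ?mul1r // /cabs /= expr0n expr1n add0r sqrtr1.
Qed.

(** The limit is found as the lower limit, the supremum of the eventual lower bounds. *)
Lemma real_cauchy (u : nat -> R) :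
  (forall e, 0 < e -> exists N, forall m n, (N <= m)%N -> (N <= n)%N -> `|u m - u n| < e) ->
  exists l, forall e, 0 < e -> exists N, forall n, (N <= n)%N -> `|u n - l| < e.
Proof.
move=> Hu; pose S := [set t | exists N, forall n, (N <= n)%N -> t <= u n]%classic.
have near e : 0 < e -> exists N, forall n, (N <= n)%N ->
    S (u n - e) /\ forall t, S t -> t <= u n + e.
  move=> e0; have [N hN] := Hu _ e0; exists N => n Nn; split.
    by exists N => m Nm; have := hN _ _ Nm Nn; rewrite ltr_norml => /andP[]; lra.
  move=> t [M hM]; have := hM _ (leq_maxr N M); have := hN _ _ (leq_maxl N M) Nn.
  by rewrite ltr_norml => /andP[]; lra.
have [N1 h1] := near 1 ltr01; have [S1 ub1] := h1 _ (leqnn N1).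
have hS : has_sup S by split; [exists (u N1 - 1)|exists (u N1 + 1)].
exists (sup S) => e e0; have e20 : 0 < e / 2 by lra.
have [N hN] := near _ e20; exists N => n /hN[Sn ubn].
have lo : u n - e / 2 <= sup S by apply: ub_le_sup => //; exists (u N1 + 1).
have hi : sup S <= u n + e / 2 by apply: sup_le_ub => //; case: hS.
by rewrite ltr_norml; apply/andP; split; lra.
Qed.

Lemma complex_cauchy (u : nat -> R[i]) :
  (forall e, 0 < e -> exists N, forall m n, (N <= m)%N -> (N <= n)%N -> cabs (u m - u n) < e) ->
  exists l, forall e, 0 < e -> exists N, forall n, (N <= n)%N -> cabs (u n - l) < e.
Proof.
move=> Hu.
have [|a Ha] := @real_cauchy (fun n => complex.Re (u n)).
  move=> e /Hu[N hN]; exists N => m n Nm Nn; apply: le_lt_trans (hN _ _ Nm Nn).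
  by have := Re_le_cabs (u m - u n); case: (u m) (u n) => [? ?] [? ?].
have [|b Hb] := @real_cauchy (fun n => complex.Im (u n)).
  move=> e /Hu[N hN]; exists N => m n Nm Nn; apply: le_lt_trans (hN _ _ Nm Nn).
  by have := Im_le_cabs (u m - u n); case: (u m) (u n) => [? ?] [? ?].
exists (Complex a b) => e e0; have e20 : 0 < e / 2 by lra.
have [M hM] := Ha _ e20; have [N hN] := Hb _ e20.
exists (maxn M N) => n; rewrite geq_max => /andP[/hM h1 /hN h2].
apply: le_lt_trans (cabs_le _) _; case: (u n) h1 h2 => [c d] /=; lra.
Qed.

End Cauchy.

(** Subtracting one rank-one form makes [y] null, so [q x y] equals [cconj (l x) * l y]; positivity
    of the remainder at [x] bounds [|l x|^2] by [q x x]. *)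
Lemma form_CS (R : realType) (V : lmodType R[i]) (q : V -> V -> R[i]) x y :
  psd_form q -> `|q x y| ^+ 2 <= q x x * q y y.
Proof.
move=> Hq; have [y0|ny] := eqVneq (q y y) 0.
  by rewrite (form_null Hq) // y0 mulr0 normr0 expr0n.
have [l [Hl ey]] := form_reduce Hq ny.
have exy : q x y = cconj (l x) * l y.
  by apply/eqP; rewrite -subr_eq0; apply/eqP/(form_null Hl); rewrite ey subrr.
have := form_ge0 Hl x; rewrite subr_ge0 => h.
rewrite exy ey -mul_cconj rmorphM /= cconjK mulrACA.
have -> : l y * cconj (l y) = cconj (l y) * l y by rewrite mulrC.
by apply: ler_wpM2r h; rewrite mulrC mul_cconj exprn_ge0.
Qed.

(** * The inner product on column vectors *)

Section InnerProduct.
Variables (R : realType) (n : nat).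
Implicit Types (u v w : 'cV[R[i]]_n) (M : 'M[R[i]]_n).

Definition ip u v := \sum_i cconj (u i ord0) * v i ord0.

Lemma ip_form : psd_form ip.
Proof.
split=> [x y z|c x y|x y|x]; rewrite /ip.
- by rewrite -big_split; apply: eq_bigr => i _; rewrite mxE mulrDr.
- by rewrite mulr_sumr; apply: eq_bigr => i _; rewrite mxE mulrCA.
- by rewrite rmorph_sum; apply: eq_bigr => i _ /=; rewrite rmorphM /= cconjK mulrC.
- by apply: sumr_ge0 => i _; rewrite mulrC mul_cconj exprn_ge0.
Qed.

Lemma vnorm_ge0 v : 0 <= vnorm v. Proof. exact: sqrtr_ge0. Qed.

Lemma ip_vnorm v : ip v v = (vnorm v ^+ 2)%:C.
Proof.
rewrite /vnorm sqr_sqrtr; last by apply: sumr_ge0 => i _; exact: sqr_ge0.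
by rewrite rmorph_sum; apply: eq_bigr => i _; rewrite cconjMl.
Qed.

Lemma ip_CS u v : cabs (ip u v) <= vnorm u * vnorm v.
Proof.
have := form_CS u v ip_form; rewrite !ip_vnorm -cabsE -rmorphM -rmorphXn lecR -exprMn.
by rewrite ler_pXn2r // nnegrE ?cabs_ge0 // mulr_ge0 ?vnorm_ge0.
Qed.

Lemma vnormZ (c : R[i]) v : vnorm (c *: v) = cabs c * vnorm v.
Proof.
have := ip_vnorm (c *: v); rewrite (formZr ip_form) (formZl ip_form) mulrCA ip_vnorm mulrA.
rewrite cconjMl -rmorphM => /complexI /eqP; rewrite -exprMn eqrXn2 ?mulr_ge0 ?cabs_ge0 ?vnorm_ge0 //.
by move=> /eqP.
Qed.

Lemma vnormD u v : vnorm (u + v) <= vnorm u + vnorm v.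
Proof.
rewrite -(@ler_pXn2r _ 2) ?nnegrE ?addr_ge0 ?vnorm_ge0 // -lecR -ip_vnorm.
have -> : ip (u + v) (u + v) = ip u u + (ip u v + cconj (ip u v)) + ip v v.
  by rewrite (formDr (@ip_form)) !(formDl (@ip_form)) -(formC (@ip_form) u v) !addrA (addrAC (ip u u)).
have -> : ip u v + cconj (ip u v) = (complex.Re (ip u v) + complex.Re (ip u v))%:C.
  by case: (ip u v) => a b; rewrite /cconj; apply/eqP; rewrite eq_complex /= subrr !eqxx.
rewrite !ip_vnorm -!rmorphD lecR.
have := ip_CS u v; have := Re_le_cabs (ip u v); rewrite ler_norml => /andP[_].
by move=> h1 h2; rewrite sqrrD mulr2n; lra.
Qed.

Lemma vnorm_eq0 v : vnorm v = 0 -> v = 0.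
Proof.
move=> e; have /eqP : ip v v = 0 by rewrite ip_vnorm e expr0n.
rewrite psumr_eq0 => [/allP h|i _]; last by rewrite mulrC mul_cconj exprn_ge0.
apply/matrixP => i j; rewrite mxE ord1.
have := h i (mem_index_enum _); rewrite mulrC mul_cconj expf_eq0 normr_eq0 /=.
by move=> /eqP.
Qed.

Lemma vnorm0 : vnorm (0 : 'cV[R[i]]_n) = 0.
Proof. by rewrite -(scale0r 0) vnormZ -[X in cabs X]/(0%:C) cabs_real normr0 mul0r. Qed.

Lemma ip_adj M u v : ip u (M *m v) = ip (mx_adj M *m u) v.
Proof.
rewrite /ip; under eq_bigr do rewrite mxE mulr_sumr.
rewrite exchange_big; apply: eq_bigr => j _; rewrite mxE rmorph_sum mulr_suml.
by apply: eq_bigr => i _ /=; rewrite !mxE rmorphM /= cconjK mulrA [cconj _ * M i j]mulrC.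
Qed.

Lemma mx_adjK M : mx_adj (mx_adj M) = M.
Proof. by apply/matrixP => i j; rewrite !mxE cconjK. Qed.

Lemma mx_adjM M N : mx_adj (M *m N) = mx_adj N *m mx_adj M.
Proof.
apply/matrixP => i j; rewrite !mxE rmorph_sum; apply: eq_bigr => k _ /=.
by rewrite !mxE rmorphM mulrC.
Qed.

End InnerProduct.

(** * The operator norm and the C*-algebra of matrices *)

Section OpNorm.
Variables (R : realType) (n : nat).
Implicit Types (u v w : 'cV[R[i]]_n) (M N : 'M[R[i]]_n).

Lemma entry_le_vnorm v i : cabs (v i ord0) <= vnorm v.
Proof.
rewrite -(@ler_pXn2r _ 2) ?nnegrE ?cabs_ge0 ?vnorm_ge0 //.
rewrite /vnorm [leRHS]sqr_sqrtr; last by apply: sumr_ge0 => k _; exact: sqr_ge0.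
by rewrite (bigD1 i) //= lerDl; apply: sumr_ge0 => k _; exact: sqr_ge0.
Qed.

Lemma mulmx_bound M : exists K, forall v, vnorm v <= 1 -> vnorm (M *m v) <= K.
Proof.
exists (\sum_j vnorm (col j M)) => v v1.
have -> : M *m v = \sum_j v j ord0 *: col j M.
  apply/matrixP => i k; rewrite mxE summxE ord1; apply: eq_bigr => j _.
  by rewrite !mxE mulrC.
have le_sum (s : seq 'I_n) :
    vnorm (\sum_(j <- s) v j ord0 *: col j M) <= \sum_(j <- s) vnorm (v j ord0 *: col j M).
  elim: s => [|j s IH]; first by rewrite !big_nil vnorm0.
  by rewrite !big_cons; apply: le_trans (vnormD _ _) _; rewrite lerD2l.
apply: le_trans (le_sum _) _; apply: ler_sum => j _.
rewrite vnormZ ler_piMl ?vnorm_ge0 //.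
by apply: le_trans (entry_le_vnorm v j) v1.
Qed.

Definition opn M : R := sup [set r | exists v, vnorm v <= 1 /\ r = vnorm (M *m v)]%classic.

Lemma opn_is_opnorm M : is_opnorm M (opn M).
Proof.
have [K hK] := mulmx_bound M; split=> [r [v [v1 ->]]|t ht].
  by apply: ub_le_sup; [exists K => _ [w [w1 ->]]; exact: hK|exists v].
by apply: sup_le_ub => //; exists (vnorm (M *m 0)), 0; rewrite vnorm0.
Qed.

Lemma opn_ge0 M : 0 <= opn M.
Proof.
have [h _] := opn_is_opnorm M; apply: le_trans (vnorm_ge0 (M *m 0)) _.
by apply: h; exists 0; rewrite vnorm0.
Qed.

Lemma opnP M v : vnorm (M *m v) <= opn M * vnorm v.
Proof.
have [v0|nv] := eqVneq (vnorm v) 0.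
  by rewrite (vnorm_eq0 v0) mulmx0 vnorm0 mulr0.
have vp : 0 < vnorm v by rewrite lt_def nv vnorm_ge0.
have [h _] := opn_is_opnorm M.
rewrite -ler_pdivrMr // mulrC.
apply: h; exists ((vnorm v)^-1%:C *: v).
rewrite -scalemxAr !vnormZ cabs_real ger0_norm ?invr_ge0 ?(ltW vp) //.
by rewrite mulVf.
Qed.

Lemma opn_le M t : 0 <= t -> (forall v, vnorm (M *m v) <= t * vnorm v) -> opn M <= t.
Proof.
move=> t0 ht; have [_ h] := opn_is_opnorm M; apply: h => _ [v [v1 ->]].
by apply: le_trans (ht v) _; rewrite ler_piMr.
Qed.

Lemma opnD M N : opn (M + N) <= opn M + opn N.
Proof.
apply: opn_le => [|v]; first by rewrite addr_ge0 ?opn_ge0.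
by rewrite mulmxDl mulrDl; apply: le_trans (vnormD _ _) _; rewrite lerD ?opnP.
Qed.

Lemma opnZ (c : R[i]) M : opn (c *: M) = cabs c * opn M.
Proof.
have le d N : opn (d *: N) <= cabs d * opn N.
  apply: opn_le => [|v]; first by rewrite mulr_ge0 ?cabs_ge0 ?opn_ge0.
  by rewrite -scalemxAl vnormZ -mulrA ler_wpM2l ?cabs_ge0 ?opnP.
apply/eqP; rewrite eq_le le /=.
have [->|c0] := eqVneq c 0.
  by rewrite -[X in cabs X]/(0%:C) cabs_real normr0 mul0r opn_ge0.
have := le c^-1 (c *: M); rewrite scalerA mulVf // scale1r => h.
apply: le_trans (ler_wpM2l (cabs_ge0 c) h) _.
by rewrite mulrA -cabsM divff // -[X in cabs X]/(1%:C) cabs_real normr1 mul1r.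
Qed.

Lemma opnM M N : opn (M *m N) <= opn M * opn N.
Proof.
apply: opn_le => [|v]; first by rewrite mulr_ge0 ?opn_ge0.
rewrite -mulmxA -mulrA; apply: le_trans (opnP _ _) _.
by rewrite ler_wpM2l ?opn_ge0 ?opnP.
Qed.

Lemma opn_entry M i j : cabs (M i j) <= opn M.
Proof.
pose e : 'cV[R[i]]_n := delta_mx j ord0.
have -> : M i j = (M *m e) i ord0 by rewrite /e -colE !mxE.
apply: le_trans (entry_le_vnorm _ _) _; apply: le_trans (opnP _ _) _.
rewrite (_ : vnorm e = 1) ?mulr1 //.
rewrite /vnorm (bigD1 j) //= big1 ?addr0 => [|k kj].
  by rewrite mxE !eqxx -[X in cabs X]/(1%:C) cabs_real normr1 expr1n sqrtr1.
by rewrite mxE (negPf kj) -[X in cabs X]/(0%:C) cabs_real normr0 expr0n.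
Qed.

Lemma opn0 : opn (0 : 'M[R[i]]_n) = 0.
Proof. by rewrite -(scale0r 0) opnZ -[X in cabs X]/(0%:C) cabs_real normr0 mul0r. Qed.

Lemma opn_le_entries M : opn M <= \sum_i \sum_j cabs (M i j) * opn (delta_mx i j).
Proof.
rewrite {1}(matrix_sum_delta M).
have le_sum (I : finType) (F : I -> 'M[R[i]]_n) : opn (\sum_i F i) <= \sum_i opn (F i).
  elim/big_rec2: _ => [|i y1 y2 _ IH]; first by rewrite opn0.
  by apply: le_trans (opnD _ _) _; rewrite lerD2l.
apply: le_trans (le_sum _ _) _; apply: ler_sum => i _.
by apply: le_trans (le_sum _ _) _; apply: ler_sum => j _; rewrite opnZ.
Qed.

Lemma vnorm_sq_adj M v : ((vnorm (M *m v)) ^+ 2)%:C = ip v (mx_adj M *m M *m v).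
Proof. by rewrite -ip_vnorm -mulmxA [RHS]ip_adj mx_adjK. Qed.

Lemma vnorm_le_adj M v : vnorm (M *m v) ^+ 2 <= opn (mx_adj M *m M) * vnorm v ^+ 2.
Proof.
have : cabs (ip v (mx_adj M *m M *m v)) <= opn (mx_adj M *m M) * vnorm v ^+ 2.
  by apply: le_trans (ip_CS _ _) _; rewrite expr2 mulrCA ler_wpM2l ?vnorm_ge0 // opnP.
by rewrite -vnorm_sq_adj cabs_real ger0_norm // sqr_ge0.
Qed.

Lemma opn_adj_le M : opn (mx_adj M) <= opn M.
Proof.
apply: opn_le => [|u]; first exact: opn_ge0.
set w := mx_adj M *m u.
have [w0|w0] := eqVneq (vnorm w) 0; first by rewrite w0 mulr_ge0 ?opn_ge0 ?vnorm_ge0.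
have wp : 0 < vnorm w by rewrite lt_def w0 vnorm_ge0.
rewrite -(ler_pM2r wp) -expr2.
have -> : vnorm w ^+ 2 = cabs (ip u (M *m w)).
  by rewrite ip_adj -/w ip_vnorm cabs_real ger0_norm // sqr_ge0.
apply: le_trans (ip_CS _ _) _; rewrite mulrAC mulrC ler_wpM2r ?vnorm_ge0 //.
exact: opnP.
Qed.

(** The universal property only speaks of C*-algebra targets, so it can produce finite-dimensional
    representations only once matrices form one. *)
Fact matrix_cstar_axioms :
  @cstar_axioms R 'M[R[i]]_n (fun M N => M *m N) (@mx_adj R n) opn.
Proof.
split.
- exact: mulmxA.
- exact: mulmxDl.
- exact: mulmxDr.
- by move=> a M N; rewrite scalemxAl.
- by move=> a M N; rewrite scalemxAr.
- exact: mx_adjK.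
- by move=> M N; apply/matrixP => i j; rewrite !mxE rmorphD.
- by move=> a M; apply/matrixP => i j; rewrite !mxE rmorphM.
- exact: mx_adjM.
- move=> M M0; apply/matrixP => i j; rewrite mxE; apply: cabs_eq0.
  by apply/eqP; rewrite eq_le cabs_ge0 andbT -M0 opn_entry.
- exact: opnD.
- exact: opnZ.
- exact: opnM.
- move=> M; apply/eqP; rewrite eq_le; apply/andP; split.
    by apply: le_trans (opnM _ _) _; rewrite expr2 ler_wpM2r ?opn_ge0 // opn_adj_le.
  have s0 := opn_ge0 (mx_adj M *m M).
  rewrite -[leRHS]sqr_sqrtr // ler_pXn2r ?nnegrE ?opn_ge0 ?sqrtr_ge0 //.
  apply: opn_le => [|v]; first exact: sqrtr_ge0.
  rewrite -(@ler_pXn2r _ 2) ?nnegrE ?mulr_ge0 ?sqrtr_ge0 ?vnorm_ge0 //.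
  by rewrite exprMn (sqr_sqrtr s0) vnorm_le_adj.
- move=> u Hu.
  have Hent (i j : 'I_n) : exists l, forall e : R, 0 < e -> exists N0 : nat, forall k, (N0 <= k)%N -> cabs (u k i j - l) < e.
    apply: complex_cauchy => e /Hu[N hN]; exists N => p q Np Nq.
    apply: le_lt_trans (hN _ _ Np Nq).
    by have := opn_entry (u p - u q) i j; rewrite !mxE.
  have [l hl] := choice (fun ij : 'I_n * 'I_n => Hent ij.1 ij.2).
  exists (\matrix_(i, j) l (i, j)) => e e0.
  (* The added [1] makes [K] positive, even in dimension 0, and turns the final bound
     [e / K * (K - 1)] into a strict one. *)
  pose K := 1 + \sum_i \sum_j opn (delta_mx i j : 'M[R[i]]_n).
  have K0 : 0 < K.
    by rewrite ltr_wpDr //; apply: sumr_ge0 => i _; apply: sumr_ge0 => j _; exact: opn_ge0.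
  have d0 : 0 < e / K by rewrite divr_gt0.
  have [N hN] := choice (fun ij => hl ij _ d0).
  exists (\max_ij N ij) => k Nk.
  have small i j : cabs ((u k - \matrix_(i, j) l (i, j)) i j) <= e / K.
    rewrite !mxE; apply/ltW/(hN (i, j)).
    by apply: leq_trans Nk; apply: (leq_bigmax (i, j)).
  apply: le_lt_trans (opn_le_entries _) _.
  apply: (@le_lt_trans _ _ (e / K * (K - 1))).
    have -> : K - 1 = \sum_i \sum_j opn (delta_mx i j : 'M[R[i]]_n) by rewrite /K addrC addKr.
    rewrite mulr_sumr; apply: ler_sum => i _; rewrite mulr_sumr.
    by apply: ler_sum => j _; rewrite ler_wpM2r ?opn_ge0.
  rewrite mulrBr mulr1 divfK ?gt_eqF //; lra.
Qed.

Definition matrix_cstar : CStarAlg R := {| cs_ax := matrix_cstar_axioms |}.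

End OpNorm.

(** * Unitaries between families with the same Gram matrix *)

Section UnitaryExtension.
Variables (R : realType) (n : nat).
Implicit Types (u v w x d : 'cV[R[i]]_n) (M : 'M[R[i]]_n).

Definition unitary M := mx_adj M *m M = 1%:M /\ M *m mx_adj M = 1%:M.

Definition rank1 d : 'M[R[i]]_n := \matrix_(i, j) (d i ord0 * cconj (d j ord0)).

Lemma rank1_mul d v : rank1 d *m v = ip d v *: d.
Proof.
apply/matrixP => i j; rewrite !mxE ord1 mulr_suml; apply: eq_bigr => k _.
by rewrite mxE mulrAC mulrC mulrA mulrAC.
Qed.

Lemma rank1_sq d : rank1 d *m rank1 d = ip d d *: rank1 d.
Proof.
apply/matrixP => i j; rewrite !mxE mulr_suml; apply: eq_bigr => k _.
by rewrite !mxE; ring.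
Qed.

Lemma rank1_adj d : mx_adj (rank1 d) = rank1 d.
Proof. by apply/matrixP => i j; rewrite !mxE rmorphM /= cconjK mulrC. Qed.

Lemma mx_adj1 : mx_adj (1%:M : 'M[R[i]]_n) = 1%:M.
Proof. by apply/matrixP => i j; rewrite !mxE eq_sym rmorph_nat. Qed.

Lemma mx_adjB M N : mx_adj (M - N) = mx_adj M - mx_adj N.
Proof. by apply/matrixP => i j; rewrite !mxE rmorphB. Qed.

Lemma mx_adjZ (c : R[i]) M : mx_adj (c *: M) = cconj c *: mx_adj M.
Proof. by apply/matrixP => i j; rewrite !mxE rmorphM. Qed.

(* A complex Householder map: the rank-one perturbation [1 - d d^* / <d, x>] of the
   identity moves [x] to [x - d]. *)
Lemma householder x w : ip x x = ip w w ->
  exists2 V, unitary V & V *m x = w /\ forall v, ip v x = ip v w -> V *m v = v.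
Proof.
move=> exw; have F := @ip_form R n; pose d := x - w.
have [d0|dn] := eqVneq d 0.
  exists 1%:M; first by rewrite /unitary mx_adj1 mul1mx.
  by split=> [|v _]; rewrite mul1mx //; apply/eqP; rewrite -subr_eq0 -/d d0.
have ipB u v y : ip u (v - y) = ip u v - ip u y.
  by rewrite (formDr F) -scaleN1r (formZr F) mulN1r.
pose om := ip d x.
(* Equality of the lengths of [x] and [w] enters here; the identity makes the divisor [om] nonzero
   and [V] unitary. *)
have dd : ip d d = om + cconj om.
  have edw : ip d w = ip x w - ip w w by rewrite (formC F) ipB rmorphB /= -!(formC F).
  have -> : ip d d = om - ip d w by rewrite -ipB.
  have -> : cconj om = ip x d by rewrite -(formC F).
  by rewrite edw ipB exw opprB.
have dd0 : ip d d != 0.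
  by apply: contraNneq dn => e; apply/eqP/vnorm_eq0/eqP; rewrite -sqrf_eq0;
     apply/eqP/complexI; rewrite -ip_vnorm e.
have om0 : om != 0 by apply: contraNneq dd0 => e; rewrite dd e rmorph0 addr0.
have com0 : cconj om != 0 by rewrite cconjE conjC_eq0.
pose V := 1%:M - om^-1 *: rank1 d.
have aV : mx_adj V = 1%:M - (cconj om)^-1 *: rank1 d.
  by rewrite mx_adjB mx_adj1 mx_adjZ fmorphV rank1_adj.
exists V.
  have VV : mx_adj V *m V = 1%:M.
    rewrite aV mulmxBl mul1mx mulmxBr mulmx1 -scalemxAl -scalemxAr rank1_sq !scalerA.
    rewrite -scalerBl -addrA -opprD -scalerDl dd.
    rewrite [X in X *: _](_ : _ = 0) ?scale0r ?subr0 //.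
    by field; rewrite om0 com0.
  by split=> //; apply: mulmx1C.
have Vv v : V *m v = v - (om^-1 * ip d v) *: d.
  by rewrite mulmxBl mul1mx -scalemxAl rank1_mul scalerA.
split=> [|v ev]; rewrite Vv; first by rewrite mulVf // scale1r /d opprB addrC subrK.
by rewrite (formC F) /d ipB ev subrr rmorph0 mulr0 scale0r subr0.
Qed.

(** Each new vector is put in place by a Householder map, which leaves the earlier ones alone:
    [ip (Y s) (U *m X y) = ip (Y s) (Y y)] is equality of the Gram matrices. No linear independence
    or choice of basis enters. *)
Lemma unitary_extension (T : eqType) (ys : seq T) (X Y : T -> 'cV[R[i]]_n) :
  {in ys &, forall s t, ip (X s) (X t) = ip (Y s) (Y t)} ->
  exists2 U, unitary U & {in ys, forall s, U *m X s = Y s}.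
Proof.
elim: ys => [|y ys IH] H.
  by exists 1%:M => //; rewrite /unitary mx_adj1 mul1mx.
have [|U [UU UU'] HU] := IH.
  by move=> u v us vs; apply: H; rewrite inE ?us ?vs orbT.
have isoU u v : ip (U *m u) (U *m v) = ip u v by rewrite ip_adj mulmxA UU mul1mx.
have [|V [VV VV'] [Vy Vfix]] := @householder (U *m X y) (Y y).
  by rewrite isoU H // inE eqxx.
exists (V *m U).
  split; rewrite mx_adjM.
    by rewrite -mulmxA (mulmxA _ V) VV mul1mx UU.
  by rewrite -mulmxA (mulmxA U) UU' mul1mx VV'.
move=> u; rewrite inE -mulmxA => /orP[/eqP-> //|us].
rewrite HU // Vfix // -{1}HU // isoU H // inE ?us ?eqxx ?orbT //.
Qed.

End UnitaryExtension.
(** * Compressing one factor to a diagonal representation *)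

Record uhom (R : realType) (A B : ucstar R) := UHom {
  uh_fun :> A -> B;
  uhD : forall x y : A, uh_fun (x + y) = uh_fun x + uh_fun y;
  uhZ : forall (c : R[i]) (x : A), uh_fun (c *: x) = c *: uh_fun x;
  uhM : forall x y : A, uh_fun (x * y) = uh_fun x * uh_fun y;
  uh_star : forall x : A, uh_fun (star x) = star (uh_fun x);
  uh1 : uh_fun 1 = 1 }.

Lemma uh0 (R : realType) (A B : ucstar R) (v : uhom A B) : v 0 = 0.
Proof. by rewrite -(scale0r (0 : A)) uhZ scale0r. Qed.

Lemma uhB (R : realType) (A B : ucstar R) (v : uhom A B) x y : v (x - y) = v x - v y.
Proof. by rewrite uhD -scaleN1r uhZ scaleN1r. Qed.

Lemma uh_Pos (R : realType) (A B : ucstar R) (v : uhom A B) a : Pos a -> Pos (v a).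
Proof.
move=> /sqrt_exists[s [Ps <- _]]; rewrite uhM.
by apply: Pos_sq; rewrite -uh_star (Pos_sa Ps).
Qed.

Section Side.
Variables (R : realType) (A P : ucstar R) (v : uhom A P) (phi : state P).
Hypothesis mulC : forall x y : A, x * y = y * x.

(** The elements of [A] that act as zero in the GNS representation of [phi]. *)
Definition phi_null (a : A) : Prop := forall y y' : P, phi (y * v a * y') = 0.

Lemma phi_null0 : phi_null 0.
Proof. by move=> y y'; rewrite uh0 mulr0 mul0r lf0. Qed.
Lemma phi_nullD a b : phi_null a -> phi_null b -> phi_null (a + b).
Proof. by move=> ha hb y y'; rewrite uhD mulrDr mulrDl lfD ha hb addr0. Qed.
Lemma phi_nullM a b : phi_null b -> phi_null (a * b).
Proof. by move=> hb y y'; rewrite uhM mulrA hb. Qed.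
Lemma phi_null_star a : phi_null a -> phi_null (star a).
Proof.
move=> ha y y'; rewrite -[y * _ * y']starK st_star !starM uh_star starK mulrA ha.
exact: rmorph0.
Qed.

Variables (as_ : seq A) (eps : R) (ys : seq P).
Hypothesis eps0 : 0 < eps.

Notation bump := (bump phi_null as_ eps).
Notation character := (character phi_null).

Lemma bump_form (g : A) : Pos g -> psd_form (fun x y : P => phi (star x * v g * y)).
Proof.
move=> Pg; have sg := Pos_sa Pg; split=> [x y z|c x y|x y|x].
- by rewrite mulrDr lfD.
- by rewrite -scalerAr lfZ.
- by rewrite -st_star !starM starK -uh_star sg mulrA.
- by apply/st_ge0/Pos_conj/uh_Pos.
Qed.

(** With [w = (a - x a) y], the total error is [phi (star w * v g * w)], that is
    [phi (star y * v (g * sqdev x a) * y)], and the defining inequality of a bump bounds it. Both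
    [y] and [v a * y] must be in [ys] because the factorization is exact only there. *)
Lemma bump_functionals (t : state A * A) : bump t -> exists L : seq (linform P),
  (forall u w, w \in ys -> \sum_(l <- L) cconj (l u) * l w = phi (star u * v t.2 * w)) /\
  (forall a y, a \in as_ -> y \in ys -> v a * y \in ys ->
     \sum_(l <- L) `|l (v a * y) - t.1 a * l y| ^+ 2 <= eps%:C * phi (star y * v t.2 * y)).
Proof.
case: t => x g /= [cx /= Pg Hg]; have F := bump_form Pg.
have [L HL] := gram_factor ys F; exists L; split=> [u w wys|a y aas yys vys].
  by rewrite HL.
pose b := a - (x a)%:A; pose w := v b * y.
have ew : w = v a * y - x a *: y.
  by rewrite /w uhB uhZ uh1 mulrBl -scalerAl mul1r.
have -> : \sum_(l <- L) `|l (v a * y) - x a * l y| ^+ 2 = phi (star w * v g * w).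
  have -> : phi (star w * v g * w) = \sum_(l <- L) cconj (l w) * l w.
    rewrite {2}ew mulrBr lfB -scalerAr lfZ HL // HL // mulr_sumr -sumrB.
    by apply: eq_bigr => l _; rewrite [X in _ = _ * l X]ew lfB lfZ mulrBr [x a * (_ * _)]mulrCA.
  by apply: eq_bigr => l _; rewrite ew lfB lfZ -mul_cconj mulrC.
have -> : star w * v g * w = star y * v (g * sqdev x a) * y.
  rewrite /w starM -uh_star (mulC g) /sqdev -/b -[_ * b * g]mulrA (mulC b).
  by rewrite !uhM !mulrA.
have Pd := uh_Pos v (Hg a aas).
have := st_ge0 phi (Pos_conj y Pd).
rewrite mulrBr uhB mulrBr mulrBl lfB subr_ge0 => h; apply: le_trans h _.
by rewrite -rscC -rscE uhZ -scalerAr -scalerAl lfZ.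
Qed.

Lemma bumps_functionals (T : seq (state A * A)) : List.Forall bump T ->
  exists L : seq (linform P * state A),
  [/\ List.Forall (fun t => character t.2) L,
      forall u w, w \in ys ->
        \sum_(t <- L) cconj (t.1 u) * t.1 w = phi (star u * v (\sum_(t <- T) t.2) * w) &
      forall a y, a \in as_ -> y \in ys -> v a * y \in ys ->
        \sum_(t <- L) `|t.1 (v a * y) - t.2 a * t.1 y| ^+ 2 <=
        eps%:C * phi (star y * v (\sum_(t <- T) t.2) * y)].
Proof.
elim=> [|[x g] T' bt _ [L [L1 L2 L3]]].
  exists [::]; split=> [|u w _|a y _ _ _]; first by constructor.
    by rewrite !big_nil uh0 mulr0 mul0r lf0.
  by rewrite !big_nil uh0 mulr0 mul0r lf0 mulr0.
have [M [M1 M2]] := bump_functionals bt; have [/= cx _ _] := bt.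
exists ([seq (l, x) | l <- M] ++ L); split=> [|u w wys|a y aas yys vys].
- apply/List.Forall_app; split=> //.
  by elim: (M) => [|l M' IH] /=; constructor.
- by rewrite big_cat big_map big_cons M1 // L2 // uhD mulrDr mulrDl lfD.
- rewrite big_cat big_map big_cons uhD mulrDr mulrDl lfD mulrDr.
  by apply: lerD; [exact: M2|exact: L3].
Qed.

Lemma side_functionals : 1 \in ys -> exists L : seq (linform P * state A),
  [/\ L <> [::], List.Forall (fun t => character t.2) L,
      forall u w, w \in ys -> \sum_(t <- L) cconj (t.1 u) * t.1 w = phi (star u * w) &
      forall a y, a \in as_ -> y \in ys -> v a * y \in ys ->
        \sum_(t <- L) `|t.1 (v a * y) - t.2 a * t.1 y| ^+ 2 <= eps%:C * phi (star y * y)].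
Proof.
move=> ys1.
have [T HT IT] := partition_of_unity mulC phi_null0 phi_nullD phi_nullM phi_null_star as_ eps0.
have [L [L1 L2 L3]] := bumps_functionals HT.
have e u w : phi (star u * v (\sum_(t <- T) t.2) * w) = phi (star u * w).
  apply/eqP; rewrite eq_sym -subr_eq0 -lfB -mulrBl -{1}[star u]mulr1 -(uh1 v) -mulrBr -uhB.
  by rewrite IT.
exists L; split=> //.
(* An empty list would give [phi 1 = 0]. Nonemptiness supplies a character for padding. *)
- move=> L0; have := L2 1 1 ys1; rewrite L0 big_nil e star1 mulr1 st1.
  by move/eqP; rewrite eq_sym oner_eq0.
- by move=> u w wys; rewrite L2 // e.
- by move=> a y aas yys vys; rewrite -e; exact: L3.
Qed.

(** The dimension is free above [K] so that both factors can be compressed to the same one. The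
    scalar clause is exact, not approximate: every character in use kills [phi_null]. *)
Theorem side_representation : 1 \in ys -> exists K, forall N, (K <= N)%N ->
  exists (D : A -> 'M[R[i]]_N) (X : P -> 'cV[R[i]]_N),
  [/\ @fd_rep R (uc_alg A) N D,
      forall a c, phi_null (a - c%:A) -> D a = c%:M,
      forall (c : R[i]) u w, X (c *: u + w) = c *: X u + X w,
      forall u w, w \in ys -> ip (X u) (X w) = phi (star u * w) &
      forall a y, a \in as_ -> y \in ys -> v a * y \in ys ->
        vnorm (X (v a * y) - D a *m X y) ^+ 2 <= eps * complex.Re (phi (star y * y))].
Proof.
move=> ys1; have [L [Ln L1 L2 L3]] := side_functionals ys1.
case: L Ln L1 L2 L3 => [/(_ erefl)//|t0 L' _].
set L := t0 :: L' => L1 L2 L3; exists (size L) => N LN.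
have cx0 : character t0.2 by inversion L1.
(* The default fills the coordinates beyond [size L]: its zero functional adds nothing to any sum,
   and its genuine character keeps [D] multiplicative and scalar where required. *)
pose d : linform P * state A := (lf_zero P, t0.2).
pose x (j : 'I_N) := (nth d L j).2; pose l (j : 'I_N) := (nth d L j).1.
have nthc M k : List.Forall (fun t => character t.2) M -> character (nth d M k).2.
  by elim: M k => [|t M IH] [|k] H //=; inversion H => //; exact: IH.
have cx j : character (x j) by exact: nthc.
have sumE (F : linform P * state A -> R[i]) : F d = 0 ->
    \sum_j F (l j, x j) = \sum_(t <- L) F t.
  move=> F0; rewrite (big_nth d) big_mkord (big_ord_widen _ (fun k => F (nth d L k)) LN).
  rewrite [RHS]big_mkcond /=; apply: eq_bigr => j _.
  rewrite /l /x -surjective_pairing; case: ltnP => // h.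
  by rewrite nth_default.
exists (fun a => diag_mx (\row_j x j a)), (fun u => \col_j l j u); split.
- split=> [a b|c a|a b|a].
  + by rewrite -raddfD; congr diag_mx; apply/rowP => j; rewrite !mxE lfD.
  + by rewrite -linearZ; congr diag_mx; apply/rowP => j; rewrite !mxE lfZ.
  + rewrite mulmx_diag; congr diag_mx; apply/rowP => j; rewrite !mxE.
    exact: (cx j).1.
  + apply/matrixP => i j; rewrite !mxE rmorphMn /= [j == i]eq_sym.
    by case: (i =P j) => [->|_]; rewrite ?mulr0n // !mulr1n; exact: st_star.
- move=> a c h; apply/matrixP => i j; rewrite !mxE; congr (_ *+ _).
  apply/eqP; rewrite -subr_eq0 -[c]mulr1 -(st1 (x i)) -lfZ -lfB.
  by apply/eqP/(cx i).2.
- by move=> c u w; apply/colP => j; rewrite !mxE lfD lfZ.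
- move=> u w wys; rewrite -L2 // -(sumE (fun t => cconj (t.1 u) * t.1 w)); last by rewrite /= mulr0.
  by apply: eq_bigr => j _; rewrite !mxE.
- move=> a y aas yys vys; rewrite -lecR -ip_vnorm rmorphM /=.
  have /ge0_real_complex[r _ er] := st_ge0 phi (Pos_starM y).
  apply: le_trans (_ : eps%:C * phi (star y * y) <= _); last by rewrite er.
  apply: le_trans (L3 a y aas yys vys).
  rewrite -(sumE (fun t => `|t.1 (v a * y) - t.2 a * t.1 y| ^+ 2)); last first.
    by rewrite /= mulr0 subrr normr0 expr0n.
  apply: ler_sum => j _; rewrite mulrC mul_cconj mul_diag_mx !mxE.
  by [].
Qed.

End Side.
(** * Closed *-subalgebras *)

Record closed_subalg (R : realType) (A : CStarAlg R) := ClosedSubalg {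
  csub :> A -> Prop;
  csub0 : csub 0;
  csubD : forall x y, csub x -> csub y -> csub (x + y);
  csubZ : forall (c : R[i]) x, csub x -> csub (c *: x);
  csubM : forall x y, csub x -> csub y -> csub (cs_mul x y);
  csub_star : forall x, csub x -> csub (cs_star x);
  csub_lim : forall x, (forall e : R, 0 < e -> exists2 y, csub y & @cs_norm R A (x - y) < e) ->
    csub x }.

Section Subalgebra.
Variables (R : realType) (A : CStarAlg R) (S : closed_subalg A).

Definition csub_pred : {pred cs_car A} := fun x => `[< S x >].

Fact csub_pred_closed : submod_closed csub_pred.
Proof.
split=> [|c x y]; first exact/asboolP/csub0.
by move=> /asboolP Sx /asboolP Sy; apply/asboolP/csubD => //; exact: csubZ.
Qed.
HB.instance Definition _ :=
  GRing.isSubmodClosed.Build R[i] (cs_car A) csub_pred csub_pred_closed.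

Definition csub_type : Type := {x : cs_car A | csub_pred x}.
HB.instance Definition _ := [isSub of csub_type for @sval _ _].
HB.instance Definition _ := [Choice of csub_type by <:].
HB.instance Definition _ := [SubChoice_isSubLmodule of csub_type by <:].

Lemma csub_valP (x : csub_type) : S (val x). Proof. exact/asboolP/(valP x). Qed.

Definition csub_mul (x y : csub_type) : csub_type :=
  Sub (cs_mul (val x) (val y)) (asboolT (csubM (csub_valP x) (csub_valP y))).
Definition csub_adj (x : csub_type) : csub_type :=
  Sub (cs_star (val x)) (asboolT (csub_star (csub_valP x))).

Fact csub_cstar_axioms : @cstar_axioms R csub_type csub_mul csub_adj
  (fun x => @cs_norm R A (val x)).
Proof.
have ax := cs_ax A.
split; do 1?[by move=> *; apply: val_inj; rewrite /= ?raddfD ?linearZ /=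
  ?(cs_mulA ax, cs_mulDl ax, cs_mulDr ax, cs_mulZl ax, cs_mulZr ax,
    cs_starK ax, cs_starD ax, cs_starZ ax, cs_starM ax)].
- by move=> x /(cs_nrm_eq0 ax) x0; apply: val_inj; rewrite x0 raddf0.
- by move=> x y; rewrite raddfD; exact: (cs_nrm_triangle ax).
- by move=> a x; rewrite linearZ; exact: (cs_nrmZ ax).
- by move=> x y; exact: (cs_nrmM ax).
- by move=> x; exact: (cs_cstar_id ax).
- move=> u Hu; have [|l hl] := cs_complete ax (u := fun n => val (u n)).
    by move=> e /Hu[N hN]; exists N => m n Nm Nn; rewrite -raddfB; exact: hN.
  have Sl : S l.
    apply: csub_lim => e /hl[N hN]; exists (val (u N)); first exact: csub_valP.
    rewrite -opprB -scaleN1r (cs_nrmZ ax) (_ : cabs (-1) = 1) ?mul1r ?hN //.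
    by rewrite /cabs /= oppr0 sqrrN expr1n expr0n addr0 sqrtr1.
  exists (Sub l (asboolT Sl)) => e /hl[N hN]; exists N => n Nn.
  by rewrite raddfB; exact: hN.
Qed.

Definition csub_cstar : CStarAlg R := {| cs_ax := csub_cstar_axioms |}.

End Subalgebra.

(** The universal property maps [P] into the subalgebra, and its uniqueness clause identifies the
    composite with the inclusion as the identity of [P]. *)
Lemma amalgamated_free_product_ind (R : realType) (A B C P : CStarAlg R)
    (phiA : C -> A) (phiB : C -> B) (vA : A -> P) (vB : B -> P) (S : closed_subalg P) :
  is_amalgamated_free_product phiA phiB vA vB ->
  (forall a, S (vA a)) -> (forall b, S (vB b)) -> forall p, S p.
Proof.
move=> [_ [[AD AZ AM As] _] [[BD BZ BM Bs] _] com univ] SA SB p.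
pose fA a : csub_cstar S := Sub (vA a) (asboolT (SA a)).
pose fB b : csub_cstar S := Sub (vB b) (asboolT (SB b)).
have [|||Phi [[PD PZ PM Ps] PA PB _]] := univ (csub_cstar S) fA fB.
- by split=> *; apply: val_inj; rewrite /= ?(AD, AZ, AM, As) ?raddfD ?linearZ.
- by split=> *; apply: val_inj; rewrite /= ?(BD, BZ, BM, Bs) ?raddfD ?linearZ.
- by move=> c; apply: val_inj; rewrite /= com.
have [Psi [_ _ _ uniq]] := univ P vA vB (And4 AD AZ AM As) (And4 BD BZ BM Bs) com.
have -> : p = val (Phi p).
  transitivity (Psi p); first exact: (uniq id).
  symmetry; apply: (uniq (fun q => val (Phi q))).
  - by split=> [x y|c x|x y|x]; rewrite ?PD ?PZ ?PM ?Ps ?raddfD ?linearZ.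
  - by move=> a; rewrite PA.
  - by move=> b; rewrite PB.
exact: csub_valP.
Qed.
(** * Approximate dilations *)

Lemma le_of_sqr_le (R : realType) (a b : R) : 0 <= b -> a ^+ 2 <= b ^+ 2 -> a <= b.
Proof. by move=> b0 h; have [//|ba] := leP a b; nra. Qed.

Lemma mul_div_succ_le (R : realType) (c d : R) : 0 <= c -> 0 <= d -> c * (d / (c + 1)) <= d.
Proof.
by move=> c0 d0; rewrite mulrCA ler_piMr // ler_pdivrMr; lra.
Qed.

Section Representations.
Variables (R : realType) (U : ucstar R) (n : nat) (pi : U -> 'M[R[i]]_n).
Hypothesis Hpi : @fd_rep R (uc_alg U) n pi.
Implicit Types (a b : U) (v : 'cV[R[i]]_n).

Lemma rep_sq a v : (vnorm (pi a *m v) ^+ 2)%:C = ip v (pi (star a * a) *m v).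
Proof. by case: Hpi => _ _ pM ps; rewrite vnorm_sq_adj pM ps. Qed.

(** Write [nrm a ^+ 2 - star a * a] as [k * k]; applying [pi] shows that the squared lengths of
    [pi a *m v] and [pi k *m v] sum to [nrm a ^+ 2] times that of [pi 1 *m v]. As [pi] may fail to
    be unital, [pi 1] is treated separately. *)
Lemma fd_rep_contractive a v : vnorm (pi a *m v) <= nrm a * vnorm v.
Proof.
have [pD pZ pM ps] := Hpi; have F := @ip_form R n.
have p1 : vnorm (pi 1 *m v) <= vnorm v.
  have [e|ne] := eqVneq (vnorm (pi 1 *m v)) 0; first by rewrite e vnorm_ge0.
  have pos : 0 < vnorm (pi 1 *m v) by rewrite lt_def ne vnorm_ge0.
  have := ip_CS v (pi 1 *m v).
  have -> : ip v (pi 1 *m v) = (vnorm (pi 1 *m v) ^+ 2)%:C by rewrite rep_sq star1 mulr1.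
  by rewrite cabs_real ger0_norm ?sqr_ge0 // expr2 ler_pM2r.
have [k [Pk kk _]] := sqrt_exists (Pos_nrm2B a).
have e : (nrm a ^+ 2)%:C * ip v (pi 1 *m v) =
    (vnorm (pi a *m v) ^+ 2)%:C + (vnorm (pi k *m v) ^+ 2)%:C.
  transitivity (ip v (pi (star a * a) *m v) + ip v (pi (star k * k) *m v)); last first.
    by congr (_ + _); rewrite rep_sq.
  rewrite -(formDr F) -mulmxDl -pD (Pos_sa Pk).
  have -> : star a * a + k * k = (nrm a ^+ 2)%:C *: 1 by rewrite kk addrC subrK.
  by rewrite pZ -scalemxAl (formZr F).
have h1 : ip v (pi 1 *m v) = (vnorm (pi 1 *m v) ^+ 2)%:C by rewrite rep_sq star1 mulr1.
move: e; rewrite h1 -rmorphM -rmorphD => /complexI e.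
apply: le_of_sqr_le; first exact: mulr_ge0 (nrm_ge0 a) (vnorm_ge0 v).
have s1 : vnorm (pi 1 *m v) ^+ 2 <= vnorm v ^+ 2.
  by apply: lerXn2r p1; rewrite nnegrE vnorm_ge0.
have := ler_wpM2l (sqr_ge0 (nrm a)) s1; rewrite e exprMn => h.
by apply: le_trans h; rewrite lerDl sqr_ge0.
Qed.

Lemma fd_rep_opn_le a : opn (pi a) <= nrm a.
Proof. by apply: opn_le => [|v]; [exact: nrm_ge0|exact: fd_rep_contractive]. Qed.

End Representations.

Section Approximation.
Variables (R : realType) (P : ucstar R) (phi : state P) (letter : P -> Prop).
Implicit Types (x y z : P) (ys zs : seq P).

Definition near_dilation ys zs (e : R) N (sigma : P -> 'M[R[i]]_N) (Y : P -> 'cV[R[i]]_N) :=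
  [/\ @fd_rep R (uc_alg P) N sigma,
      forall (c : R[i]) u w, Y (c *: u + w) = c *: Y u + Y w,
      forall u w, w \in ys -> ip (Y u) (Y w) = phi (star u * w) &
      forall z y, z \in zs -> y \in ys -> z * y \in ys ->
        vnorm (Y (z * y) - sigma z *m Y y) ^+ 2 <= e * complex.Re (phi (star y * y))].

(* [x] is almost intertwined by the vectors of every near dilation that is exact on
   enough vectors and precise enough on enough letters. *)
Definition approximable x := forall y (d : R), 0 < d -> exists ys zs (e : R),
  [/\ 0 < e, forall z, z \in zs -> letter z &
    forall N (sigma : P -> 'M[R[i]]_N) (Y : P -> 'cV[R[i]]_N),
      near_dilation ys zs e sigma Y -> vnorm (Y (x * y) - sigma x *m Y y) <= d].

Lemma near_dilation_mono ys zs e ys' zs' e' N (sigma : P -> 'M[R[i]]_N) Y :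
  {subset ys <= ys'} -> {subset zs <= zs'} -> e' <= e ->
  near_dilation ys' zs' e' sigma Y -> near_dilation ys zs e sigma Y.
Proof.
move=> sy sz le [H1 H2 H3 H4]; split=> //.
  by move=> u w /sy; exact: H3.
move=> z y /sz hz /sy hy /sy hzy; apply: le_trans (H4 _ _ hz hy hzy) _.
apply: ler_wpM2r le.
by have /ge0_real_complex[r r0 ->] := st_ge0 phi (Pos_starM y).
Qed.

Lemma approximable_letter x : letter x -> approximable x.
Proof.
move=> lx y d d0; have /ge0_real_complex[K K0 eK] := st_ge0 phi (Pos_starM y).
have K1 : 0 < K + 1 by lra.
exists [:: y; x * y], [:: x], (d ^+ 2 / (K + 1)); split.
- by rewrite divr_gt0 ?exprn_gt0.
- by move=> z; rewrite inE => /eqP->.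
move=> N sigma Y [_ _ _ /(_ x y)]; rewrite !inE !eqxx orbT eK => /(_ isT isT isT) /= h.
apply: (le_of_sqr_le (ltW d0)); apply: le_trans h _.
by rewrite mulrAC ler_pdivrMr // ler_wpM2l ?sqr_ge0 //; lra.
Qed.

Lemma approximable_lin (c : R[i]) x1 x2 :
  approximable x1 -> approximable x2 -> approximable (c *: x1 + x2).
Proof.
move=> a1 a2 y d d0; have c0 := cabs_ge0 c.
have d1 : 0 < d / 2 / (cabs c + 1) by rewrite !divr_gt0 //; lra.
have d2 : 0 < d / 2 by lra.
have [ys1 [zs1 [e1 [e10 l1 h1]]]] := a1 y _ d1.
have [ys2 [zs2 [e2 [e20 l2 h2]]]] := a2 y _ d2.
exists (ys1 ++ ys2), (zs1 ++ zs2), (Num.min e1 e2); split.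
- by rewrite lt_min e10.
- by move=> z; rewrite mem_cat => /orP[/l1|/l2].
move=> N sigma Y HY; have [[pD pZ _ _] lY _ _] := HY.
have g1 : vnorm (Y (x1 * y) - sigma x1 *m Y y) <= d / 2 / (cabs c + 1).
  apply: h1; apply: near_dilation_mono HY; rewrite ?ge_min ?lexx //.
    by move=> z; rewrite mem_cat => ->.
  by move=> z; rewrite mem_cat => ->.
have g2 : vnorm (Y (x2 * y) - sigma x2 *m Y y) <= d / 2.
  apply: h2; apply: near_dilation_mono HY; rewrite ?ge_min ?lexx ?orbT //.
    by move=> z; rewrite mem_cat => ->; rewrite orbT.
  by move=> z; rewrite mem_cat => ->; rewrite orbT.
rewrite mulrDl -scalerAl lY pD pZ mulmxDl -scalemxAl opprD addrACA -scalerBr.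
apply: le_trans (vnormD _ _) _; rewrite vnormZ.
rewrite [leRHS]splitr; apply: lerD g2.
exact: le_trans (ler_wpM2l c0 g1) (mul_div_succ_le c0 (ltW d2)).
Qed.

(** Telescoping through [sigma x1 *m Y (x2 * y)]: the first factor is used at the vector [x2 * y],
    which is why [approximable] quantifies over all [y]. *)
Lemma approximableM x1 x2 :
  approximable x1 -> approximable x2 -> approximable (x1 * x2).
Proof.
move=> a1 a2 y d d0; have c0 := nrm_ge0 x1.
have d2 : 0 < d / 2 / (nrm x1 + 1) by rewrite !divr_gt0 //; lra.
have d1 : 0 < d / 2 by lra.
have [ys1 [zs1 [e1 [e10 l1 h1]]]] := a1 (x2 * y) _ d1.
have [ys2 [zs2 [e2 [e20 l2 h2]]]] := a2 y _ d2.
exists (ys1 ++ ys2), (zs1 ++ zs2), (Num.min e1 e2); split.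
- by rewrite lt_min e10.
- by move=> z; rewrite mem_cat => /orP[/l1|/l2].
move=> N sigma Y HY; have [Hs _ _ _] := HY; have [_ _ pM _] := Hs.
have g1 : vnorm (Y (x1 * (x2 * y)) - sigma x1 *m Y (x2 * y)) <= d / 2.
  apply: h1; apply: near_dilation_mono HY; rewrite ?ge_min ?lexx //.
    by move=> z; rewrite mem_cat => ->.
  by move=> z; rewrite mem_cat => ->.
have g2 : vnorm (Y (x2 * y) - sigma x2 *m Y y) <= d / 2 / (nrm x1 + 1).
  apply: h2; apply: near_dilation_mono HY; rewrite ?ge_min ?lexx ?orbT //.
    by move=> z; rewrite mem_cat => ->; rewrite orbT.
  by move=> z; rewrite mem_cat => ->; rewrite orbT.
rewrite -mulrA pM -mulmxA -[Y _](subrK (sigma x1 *m Y (x2 * y))) -addrA -mulmxBr.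
apply: le_trans (vnormD _ _) _.
have g3 := fd_rep_contractive Hs x1 (Y (x2 * y) - sigma x2 *m Y y).
rewrite [leRHS]splitr; apply: lerD g1 (le_trans g3 _).
exact: le_trans (ler_wpM2l c0 g2) (mul_div_succ_le c0 (ltW d1)).
Qed.

Lemma approximable_lim x :
  (forall e : R, 0 < e -> exists2 x', approximable x' & nrm (x - x') < e) -> approximable x.
Proof.
move=> Hx y d d0; have /ge0_real_complex[K K0 eK] := st_ge0 phi (Pos_starM y).
have k0 := sqrtr_ge0 K; have y0 := nrm_ge0 y.
pose T := Num.sqrt K + nrm y + 1; have T0 : 0 < T by rewrite /T; lra.
have e0 : 0 < d / 2 / T by rewrite !divr_gt0.
have d2 : 0 < d / 2 by lra.
have [x' ax' nx] := Hx _ e0; have [ys [zs [e [ep lz h]]]] := ax' y _ d2.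
pose w := (x - x') * y.
(* Listing [y] and [w] makes the lengths of [Y y] and [Y w] computable from [phi], so they are
   bounded uniformly in the dimension. *)
exists ([:: y; w] ++ ys), zs, e; split=> // N sigma Y HY.
have g1 : vnorm (Y (x' * y) - sigma x' *m Y y) <= d / 2.
  by apply: h; apply: near_dilation_mono HY => // z zy; rewrite mem_cat zy orbT.
have [Hs lY ipY _] := HY; have [pD pZ _ _] := Hs.
have Yy : vnorm (Y y) = Num.sqrt K.
  have := ip_vnorm (Y y); rewrite ipY ?mem_cat ?inE ?eqxx // eK => /complexI ->.
  by rewrite sqrtr_sqr ger0_norm ?vnorm_ge0.
have Yw : vnorm (Y w) <= nrm (x - x') * nrm y.
  apply: le_of_sqr_le; first exact: mulr_ge0 (nrm_ge0 _) (nrm_ge0 _).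
  rewrite -lecR -ip_vnorm.
  rewrite ipY ?mem_cat ?inE ?eqxx ?orbT //.
  apply: (@le_trans _ _ ((nrm w) ^+ 2)%:C).
    rewrite -subr_ge0 -(st_rsc phi) -lfB; apply: st_ge0; exact: Pos_nrm2B.
  rewrite lecR; apply: lerXn2r (nrmM _ _); rewrite nnegrE; first exact: nrm_ge0.
  exact: mulr_ge0 (nrm_ge0 _) (nrm_ge0 _).
have sB : sigma (x - x') = sigma x - sigma x'.
  by rewrite -scaleN1r pD pZ scaleN1r.
have -> : Y (x * y) - sigma x *m Y y =
    (Y (x' * y) - sigma x' *m Y y) + (Y w - sigma (x - x') *m Y y).
  have -> : x * y = 1 *: w + x' * y by rewrite scale1r /w mulrBl subrK.
  rewrite lY scale1r sB mulmxBl opprB addrACA [in RHS](addrC (Y _)) -!addrA; congr (_ + (_ + _)).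
  by rewrite addrA addNr add0r.
have g2 := fd_rep_contractive Hs (x - x') (Y y); rewrite Yy in g2.
have t1 := vnormD (Y (x' * y) - sigma x' *m Y y) (Y w - sigma (x - x') *m Y y).
have t2 := vnormD (Y w) (- (sigma (x - x') *m Y y)).
have vN u : vnorm (- u : 'cV[R[i]]_N) = vnorm u.
  by rewrite -scaleN1r vnormZ (_ : cabs (-1) = 1) ?mul1r //
     /cabs /= oppr0 sqrrN expr1n expr0n addr0 sqrtr1.
rewrite vN in t2.
have hT : nrm (x - x') * T <= d / 2 by rewrite -ler_pdivlMr // ltW.
apply: le_trans t1 _; rewrite [leRHS]splitr; apply: lerD g1 (le_trans t2 _).
apply: le_trans (lerD Yw g2) _; rewrite -mulrDr; apply: le_trans hT.
by apply: ler_wpM2l; [exact: nrm_ge0|rewrite /T; lra].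
Qed.

End Approximation.
(** * Amalgamated free products *)

(** A state nonnegative at [- g = h - nrm h] attains the norm of [h]. The coefficients [z] of [g]
    are central rather than scalar because the cone must be stable under central multipliers. *)
Lemma norming_state (R : realType) (U : ucstar R) (p : U) :
  exists phi : state U, ((nrm p ^+ 2)%:C <= phi (star p * p)) /\
    forall c y, central c -> phi (c * y) = phi c * phi y.
Proof.
pose h := star p * p; have Ph : Pos h := Pos_starM p.
pose T := nrm h; pose g := T%:U - h; have Pg : Pos g by apply: Pos_nrmB; exact: Pos_sa.
pose N0 a := exists b z, [/\ Pos b, Pos z, central z & a = b - z * g].
have [|phi [phi0 phiM]] := @state_exists R U N0.
  split.
  - by move=> a [b [z [Pb Pz cz ->]]]; rewrite starB starM !Pos_sa // cz.
  - move=> a Pa; exists a, 0; split=> //; [exact: Pos0| |by rewrite mul0r subr0].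
    by move=> x; rewrite mul0r mulr0.
  - move=> a b [a' [z [Pa Pz cz ->]]] [b' [z' [Pb Pz' cz' ->]]].
    exists (a' + b'), (z + z'); split; [exact: PosD|exact: PosD|exact: centralD|].
    by rewrite mulrDl opprD addrACA.
  - move=> k a [Pk ck] [b [z [Pb Pz cz ->]]].
    exists (k * b), (k * z); split; [exact: PosM|exact: PosM|exact: centralM|].
    by rewrite mulrBr mulrA.
  - move=> [b [z [Pb Pz cz e]]].
    pose S := nrm z + 1; have S0 : 0 < S by have := nrm_ge0 z; rewrite /S; lra.
    have PSz : Pos (S%:U - z).
      by rewrite /S rscD addrAC; apply: PosD; [exact: Pos_nrmB (Pos_sa Pz)|exact: Pos_rsc].
    (* [S g >= z g = 1 + b >= 1], so [h <= T - 1/S]. *)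
    have P1 : Pos (S%:U * g - 1).
      have -> : S%:U * g - 1 = (S%:U - z) * g + b by rewrite e mulrBl addrA addrAC.
      apply: PosD => //; apply: PosM => //.
      by rewrite mulrBl [RHS]mulrBr (cz g) rscC.
    have P2 : Pos ((T - S^-1)%:U - h).
      have -> : (T - S^-1)%:U - h = S^-1%:U * (S%:U * g - 1).
        by rewrite mulrBr mulrA -rscM mulVf ?gt_eqF // rsc1 mul1r mulr1 rscB addrAC.
      by apply: Pos_rscM => //; rewrite invr_ge0 ltW.
    have := nrm_le_Pos Ph P2; rewrite -/T.
    have Si : 0 < S^-1 by rewrite invr_gt0.
    lra.
exists phi; split=> //; rewrite -nrm_starM -/h -/T -(st_rsc phi) -subr_ge0 -lfB.
apply: phi0; exists 0, 1; split; [exact: Pos0|exact: Pos1| |].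
  by move=> x; rewrite mul1r mulr1.
by rewrite mul1r sub0r opprB.
Qed.

Section FreeProduct.
Variables (R : realType) (A B P : ucstar R) (C : CStarAlg R).
Variables (phiA : C -> uc_alg A) (phiB : C -> uc_alg B) (v : uhom A P) (w : uhom B P).
Hypothesis mulCA : forall x y : A, x * y = y * x.
Hypothesis mulCB : forall x y : B, x * y = y * x.
Hypothesis phiA_star : forall c, phiA (cs_star c) = cs_star (phiA c).
Hypothesis HP : @is_amalgamated_free_product R (uc_alg A) (uc_alg B) C (uc_alg P) phiA phiB v w.

Let vw c : v (phiA c) = w (phiB c). Proof. by case: HP. Qed.

Lemma limit_eq (f : P -> P) (K : R) (x : P) :
  (forall y z : P, nrm (f y - f z) <= K * nrm (y - z)) ->
  (forall e : R, 0 < e -> exists2 y, f y = 0 & nrm (x - y) < e) -> f x = 0.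
Proof.
move=> Hf Hx; apply: nrm_eq0; apply/eqP; rewrite eq_le nrm_ge0 andbT.
apply/ler_addgt0Pr => e e0; rewrite add0r.
have K1 : 0 < `|K| + 1 by have := normr_ge0 K; lra.
have [y fy ny] := Hx _ (divr_gt0 e0 K1).
have := Hf x y; rewrite fy subr0 => h; apply: le_trans h _.
have h2 : K * nrm (x - y) <= (`|K| + 1) * nrm (x - y).
  by apply: ler_wpM2r; [exact: nrm_ge0|have := ler_norm K; lra].
by apply: le_trans h2 _; rewrite mulrC -ler_pdivlMr // ltW.
Qed.

Lemma free_product_ind (S : P -> Prop) :
  S 0 -> (forall x y, S x -> S y -> S (x + y)) -> (forall (c : R[i]) x, S x -> S (c *: x)) ->
  (forall x y, S x -> S y -> S (x * y)) -> (forall x, S x -> S (star x)) ->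
  (forall x, (forall e : R, 0 < e -> exists2 y, S y & nrm (x - y) < e) -> S x) ->
  (forall a, S (v a)) -> (forall b, S (w b)) -> forall p, S p.
Proof.
move=> S0 SD SZ SM Ss Sl.
exact: (amalgamated_free_product_ind (S := @ClosedSubalg R (uc_alg P) S S0 SD SZ SM Ss Sl) HP).
Qed.

(** The commutant of the image of [C] is a closed *-subalgebra; it contains the images of [A] and
    [B] by commutativity, the amalgamation moving [C] from one to the other. *)
Lemma amalgam_central c : central (v (phiA c)).
Proof.
(* Quantifying over [c] inside [S] is what makes it stable under [star], which exchanges the images
   of [c] and [cs_star c]. *)
pose S (p : P) := forall c, p * v (phiA c) = v (phiA c) * p.
move=> p; symmetry; move: p c; apply: (@free_product_ind S).
- by move=> d; rewrite mul0r mulr0.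
- by move=> x y Sx Sy d; rewrite mulrDl mulrDr Sx Sy.
- by move=> k x Sx d; rewrite -scalerAl -scalerAr Sx.
- by move=> x y Sx Sy d; rewrite -mulrA Sy mulrA Sx mulrA.
- move=> x Sx d.
  have sd : v (phiA d) = star (v (phiA (cs_star d))).
    by rewrite -uh_star phiA_star; congr (v _); rewrite -[LHS]starK.
  by rewrite sd -!starM Sx.
- move=> x Hx d; apply/eqP; rewrite -subr_eq0; apply/eqP.
  apply: (@limit_eq (fun p => p * v (phiA d) - v (phiA d) * p) (nrm (v (phiA d)) + nrm (v (phiA d)))).
    move=> y z; set a := v (phiA d).
    have -> : y * a - a * y - (z * a - a * z) = (y - z) * a - a * (y - z).
      by rewrite mulrBl mulrBr !opprB (addrC (a * z)) addrACA (addrC (- (a * y))).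
    apply: le_trans (nrmD _ _) _; rewrite nrmN [leRHS]mulrDl.
    by apply: lerD; [rewrite [leRHS]mulrC|]; exact: nrmM.
  by move=> e /Hx[y Sy ny]; exists y => //; rewrite Sy subrr.
- by move=> a d; rewrite -!uhM mulCA.
- by move=> b d; rewrite vw -!uhM mulCB.
Qed.

Definition letter (z : P) : Prop := (exists a, z = v a) \/ (exists b, z = w b).

Lemma letter_star z : letter z -> letter (star z).
Proof. by case=> [[a ->]|[b ->]]; [left; exists (star a)|right; exists (star b)]; rewrite uh_star. Qed.

Lemma approximable_all (phi : state P) p : approximable phi letter p.
Proof.
(* Approximability is not visibly stable under [star], so the induction carries both [x] and
   [star x]. *)
pose S x := approximable phi letter x /\ approximable phi letter (star x).
have a0 : approximable phi letter 0.
  by rewrite -(uh0 v); apply: approximable_letter; left; exists 0.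
have aD x y : approximable phi letter x -> approximable phi letter y -> approximable phi letter (x + y).
  by move=> ax ay; have := approximable_lin 1 ax ay; rewrite scale1r.
have aZ (c : R[i]) x : approximable phi letter x -> approximable phi letter (c *: x).
  by move=> ax; have := approximable_lin c ax a0; rewrite addr0.
have SL z : letter z -> S z.
  move=> lz; split; first exact: approximable_letter.
  exact/approximable_letter/letter_star.
suff : S p by case.
move: p; apply: (@free_product_ind S).
- by split; rewrite ?star0.
- by move=> x y [x1 x2] [y1 y2]; split; rewrite ?starD; apply: aD.
- by move=> k x [x1 x2]; split; rewrite ?starZ; apply: aZ.
- by move=> x y [x1 x2] [y1 y2]; split; rewrite ?starM; apply: approximableM.
- by move=> x [x1 x2]; split; rewrite ?starK.
- move=> x Hx; split; apply: approximable_lim => e /Hx[y [y1 y2] ny].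
    by exists y.
  by exists (star y) => //; rewrite -starB nrm_star.
- by move=> a; apply: SL; left; exists a.
- by move=> b; apply: SL; right; exists b.
Qed.

Lemma letters_split (zs : seq P) : (forall z, z \in zs -> letter z) ->
  exists (as_ : seq A) (bs : seq B), forall z, z \in zs ->
    (exists2 a, a \in as_ & z = v a) \/ (exists2 b, b \in bs & z = w b).
Proof.
elim: zs => [|z zs IH] Hz; first by exists [::], [::].
have [|as_ [bs H]] := IH; first by move=> y hy; apply: Hz; rewrite inE hy orbT.
have [[a ea]|[b eb]] := Hz z (mem_head _ _).
  exists (a :: as_), bs => y; rewrite inE => /orP[/eqP->|/H[[a' h ->]|h]]; last by right.
    by left; exists a; rewrite ?mem_head.
  by left; exists a'; rewrite // inE h orbT.
exists as_, (b :: bs) => y; rewrite inE => /orP[/eqP->|/H[h|[b' h ->]]]; last 1 first.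
  by right; exists b'; rewrite // inE h orbT.
  by right; exists b; rewrite ?mem_head.
by left.
Qed.

Lemma near_dilation_exists (phi : state P) ys zs (e : R) :
  (forall c y, central c -> phi (c * y) = phi c * phi y) ->
  1 \in ys -> (forall z, z \in zs -> letter z) -> 0 < e ->
  exists N (sigma : P -> 'M[R[i]]_N) Y, near_dilation phi ys zs e sigma Y.
Proof.
move=> phiM ys1 /letters_split[as_ [bs Hzs]] e0.
have [KA HA] := side_representation v phi mulCA as_ e0 ys1.
have [KB HB] := side_representation w phi mulCB bs e0 ys1.
pose N := maxn KA KB.
have [DA [XA [rA cA lA iA nA]]] := HA N (leq_maxl _ _).
have [DB [XB [rB cB lB iB nB]]] := HB N (leq_maxr _ _).
have [|U [UU UU'] HU] := @unitary_extension R N P ys XA XB.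
  by move=> s t _ ht; rewrite iA // iB.
have [AD AZ AM As] := rA; have [BD BZ BM Bs] := rB.
pose fA a : matrix_cstar R N := U *m DA a *m mx_adj U.
pose fB b : matrix_cstar R N := DB b.
have homA : @star_hom R (uc_alg A) (matrix_cstar R N) fA.
  rewrite /fA; split=> [x y|c x|x y|x].
  - by rewrite AD mulmxDr mulmxDl.
  - by rewrite AZ -scalemxAr -scalemxAl.
  - by rewrite AM /= !mulmxA -(mulmxA _ (mx_adj U)) UU mulmx1.
  - by rewrite As /= !mx_adjM mx_adjK mulmxA.
have com c : fA (phiA c) = fB (phiB c).
  pose z := v (phiA c); pose s := phi z.
  have cz : central z := amalgam_central c.
  (* Centrality moves [z - s] to the front, where [phi] splits off the factor [phi (z - s) = 0]. *)
  have null y y' : phi (y * (z - s%:A) * y') = 0.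
    have cd : central (z - s%:A).
      by move=> x; rewrite mulrBl mulrBr cz -scalerAl -scalerAr mul1r mulr1.
    by rewrite -cd -mulrA phiM // lfB lfZ st1 mulr1 subrr mul0r.
  rewrite /fA /fB (cA _ s) ?(cB _ s).
  - by rewrite mul_mx_scalar -scalemxAl UU' scalemx1.
  - by move=> y y'; rewrite uhB uhZ uh1 -vw.
  - by move=> y y'; rewrite uhB uhZ uh1.
have [_ _ _ _ univ] := HP.
have [sigma [[sD sZ sM ss] sA sB _]] := univ (matrix_cstar R N) fA fB homA (And4 BD BZ BM Bs) com.
exists N, sigma, XB; split=> // z y hz hy hzy.
have [[a ha ez]|[b hb ez]] := Hzs z hz; rewrite ez in hzy *.
  have -> : sigma (v a) = U *m DA a *m mx_adj U := sA a.
  rewrite -HU // -(HU y) // -!mulmxA (mulmxA (mx_adj U)) UU mul1mx -mulmxBr.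
  have -> : vnorm (U *m (XA (v a * y) - DA a *m XA y)) = vnorm (XA (v a * y) - DA a *m XA y).
    apply/eqP; rewrite -(@eqrXn2 _ 2) ?vnorm_ge0 //; apply/eqP/complexI.
    by rewrite vnorm_sq_adj UU mul1mx ip_vnorm.
  exact: nA.
have -> : sigma (w b) = DB b := sB b.
exact: nB.
Qed.

Theorem amalgam_fd_norming (p : P) (d : R) : 0 < d ->
  exists N (sigma : P -> 'M[R[i]]_N), @fd_rep R (uc_alg P) N sigma /\ nrm p - d <= opn (sigma p).
Proof.
move=> d0; have [phi [phip phiM]] := norming_state p.
have [ys [zs [e [e0 lz H]]]] := approximable_all phi p 1 d0.
(* Adding [1] and [p] to the list makes the inner products that give the lengths of [Y 1] and [Y p]
   exact. *)
have [|N [sigma [Y HY]]] := near_dilation_exists (ys := [:: 1; p] ++ ys) phiM _ lz e0.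
  by rewrite mem_cat inE eqxx.
exists N, sigma; have [Hs lY iY _] := HY; split=> //.
have h : vnorm (Y (p * 1) - sigma p *m Y 1) <= d.
  by apply: H; apply: near_dilation_mono HY => // z hz; rewrite mem_cat hz orbT.
have Y1 : vnorm (Y 1) = 1.
  have := ip_vnorm (Y 1); rewrite iY ?mem_cat ?inE ?eqxx // star1 mulr1 st1 => /complexI e1.
  by apply/eqP; rewrite -(@eqrXn2 _ 2) ?vnorm_ge0 // expr1n -e1.
have Yp : nrm p <= vnorm (Y p).
  apply: le_of_sqr_le; first exact: vnorm_ge0.
  by rewrite -lecR -ip_vnorm iY // mem_cat !inE eqxx orbT.
rewrite mulr1 in h.
have := opnP (sigma p) (Y 1); rewrite Y1 mulr1 => h2.
have := vnormD (Y p - sigma p *m Y 1) (sigma p *m Y 1); rewrite subrK => h3.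
rewrite lerBlDr; apply: le_trans Yp (le_trans h3 _); rewrite addrC.
exact: lerD.
Qed.

End FreeProduct.
(** * Separability *)

Lemma uhom_contractive (R : realType) (A B : ucstar R) (v : uhom A B) a : nrm (v a) <= nrm a.
Proof.
have := uh_Pos v (Pos_nrm2B a); rewrite uhB uhM uh_star {1}/rsc uhZ uh1 => h.
by apply: le_of_sqr_le; [exact: nrm_ge0|rewrite -nrm_starM; exact: nrm_le_Pos (Pos_starM _) h].
Qed.

(** Noncommutative polynomials with coefficients in the Gaussian rationals. There is no constructor
    for the involution: the adjoint of a letter is the image of an element of the same factor, and
    other letters approximate it. *)
Inductive star_term : Type :=
  | TLetter of bool & nat
  | TScalar of rat & rat
  | TAdd of star_term & star_term
  | TMul of star_term & star_term.

Fixpoint star_term_encode (t : star_term) : GenTree.tree ((bool * nat) + (rat * rat)) :=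
  match t with
  | TLetter b n => GenTree.Leaf (inl (b, n))
  | TScalar q r => GenTree.Leaf (inr (q, r))
  | TAdd t1 t2 => GenTree.Node 0 [:: star_term_encode t1; star_term_encode t2]
  | TMul t1 t2 => GenTree.Node 1 [:: star_term_encode t1; star_term_encode t2]
  end.

Lemma star_term_encode_inj : injective star_term_encode.
Proof.
elim=> [b n|q r|t1 IH1 t2 IH2|t1 IH1 t2 IH2] [b' n'|q' r'|s1 s2|s1 s2] //=.
- by case=> -> ->.
- by case=> -> ->.
- by case=> /IH1-> /IH2->.
- by case=> /IH1-> /IH2->.
Qed.

Section Separable.
Variables (R : realType) (A B P : ucstar R) (C : CStarAlg R).
Variables (phiA : C -> uc_alg A) (phiB : C -> uc_alg B) (v : uhom A P) (w : uhom B P).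
Hypothesis HP : @is_amalgamated_free_product R (uc_alg A) (uc_alg B) C (uc_alg P) phiA phiB v w.
Variables (sA : nat -> A) (sB : nat -> B).
Hypothesis HsA : forall (x : A) (e : R), 0 < e -> exists n, nrm (x - sA n) < e.
Hypothesis HsB : forall (x : B) (e : R), 0 < e -> exists n, nrm (x - sB n) < e.

Fixpoint term_val (t : star_term) : P :=
  match t with
  | TLetter b n => if b then v (sA n) else w (sB n)
  | TScalar q r => (Complex (ratr q) (ratr r) : R[i])%:A
  | TAdd t1 t2 => term_val t1 + term_val t2
  | TMul t1 t2 => term_val t1 * term_val t2
  end.

Definition term_limit (x : P) : Prop :=
  forall e : R, 0 < e -> exists t, nrm (x - term_val t) <= e.

Lemma term_limit_lim x :
  (forall e : R, 0 < e -> exists2 y, term_limit y & nrm (x - y) <= e) -> term_limit x.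
Proof.
move=> Hx e e0; have e20 : 0 < e / 2 by lra.
have [y /(_ _ e20)[t ht] hy] := Hx _ e20; exists t; rewrite [leRHS]splitr.
exact: le_trans (nrmBD x y _) (lerD hy ht).
Qed.

Lemma term_limitD x y : term_limit x -> term_limit y -> term_limit (x + y).
Proof.
move=> Hx Hy e e0; have e20 : 0 < e / 2 by lra.
have [t ht] := Hx _ e20; have [s hs] := Hy _ e20; exists (TAdd t s) => /=.
by rewrite opprD addrACA [leRHS]splitr; exact: le_trans (nrmD _ _) (lerD ht hs).
Qed.

Lemma term_limitM x y : term_limit x -> term_limit y -> term_limit (x * y).
Proof.
move=> Hx Hy e e0; have e20 : 0 < e / 2 by lra.
have y0 := nrm_ge0 y; have [|t ht] := Hx (e / 2 / (nrm y + 1)).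
  by rewrite divr_gt0 // ltr_wpDl.
(* The precision for [y] is fixed only after [t], since the error is multiplied by [term_val t]. *)
have t0 := nrm_ge0 (term_val t); have [|s hs] := Hy (e / 2 / (nrm (term_val t) + 1)).
  by rewrite divr_gt0 // ltr_wpDl.
exists (TMul t s) => /=.
have -> : x * y - term_val t * term_val s =
    (x - term_val t) * y + term_val t * (y - term_val s).
  by rewrite mulrBl mulrBr addrA subrK.
apply: le_trans (nrmD _ _) _; rewrite [leRHS]splitr; apply: lerD.
  apply: le_trans (nrmM _ _) _; rewrite mulrC.
  exact: le_trans (ler_wpM2l y0 ht) (mul_div_succ_le y0 (ltW e20)).
apply: le_trans (nrmM _ _) _.
exact: le_trans (ler_wpM2l t0 hs) (mul_div_succ_le t0 (ltW e20)).
Qed.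

Lemma term_limit_scalar (c : R[i]) : term_limit c%:A.
Proof.
move=> e e0; have approx (a : R) : exists q : rat, `|a - ratr q| <= e / 2.
  have [|q] := @rat_in_itvoo R (a - e / 2) (a + e / 2); first lra.
  rewrite in_itv /= => /andP[h1 h2]; exists q.
  by rewrite ler_norml; apply/andP; split; lra.
case: c => a b; have [q hq] := approx a; have [r hr] := approx b.
exists (TScalar q r) => /=; rewrite -scalerBl nrmZ nrm1 mulr1 [leRHS]splitr.
by apply: le_trans (cabs_le _) _; apply: lerD; [exact: hq|exact: hr].
Qed.

Lemma term_limit_letterA a : term_limit (v a).
Proof.
move=> e e0; have [n hn] := HsA a e0; exists (TLetter true n) => /=.
by rewrite -uhB; apply: le_trans (uhom_contractive _ _) (ltW hn).
Qed.

Lemma term_limit_letterB b : term_limit (w b).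
Proof.
move=> e e0; have [n hn] := HsB b e0; exists (TLetter false n) => /=.
by rewrite -uhB; apply: le_trans (uhom_contractive _ _) (ltW hn).
Qed.

Lemma term_limit_all p : term_limit p.
Proof.
move: p; apply: (free_product_ind HP).
- by rewrite -(scale0r (1 : P)); exact: term_limit_scalar.
- exact: term_limitD.
- move=> c x hx; rewrite -[x]mul1r scalerAl; exact: term_limitM (term_limit_scalar c) hx.
- exact: term_limitM.
- have hs t : term_limit (star (term_val t)).
    elim: t => [[] n|q r|t1 h1 t2 h2|t1 h1 t2 h2] /=.
    + by rewrite -uh_star; exact: term_limit_letterA.
    + by rewrite -uh_star; exact: term_limit_letterB.
    + by rewrite starZ star1; exact: term_limit_scalar.
    + by rewrite starD; exact: term_limitD.
    + by rewrite starM; exact: term_limitM.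
  move=> x hx; apply: term_limit_lim => e /hx[t ht].
  by exists (star (term_val t)); rewrite // -starB nrm_star.
- move=> x hx; apply: term_limit_lim => e /hx[y hy ny].
  by exists y; rewrite // ltW.
- exact: term_limit_letterA.
- exact: term_limit_letterB.
Qed.

Lemma free_product_separable : separable (uc_alg P).
Proof.
pose f (t : star_term) := pickle (star_term_encode t).
have finj : injective f by move=> s t /(pcan_inj pickleK_inv)/star_term_encode_inj.
have [u hu] : exists u : nat -> P, forall t, u (f t) = term_val t.
  have h n : exists y, forall t, f t = n -> y = term_val t.
    have [[t ft]|no] := pselect (exists t, f t = n).
      by exists (term_val t) => s fs; congr term_val; apply: finj; rewrite ft fs.
    by exists 0 => t ft; case: no; exists t.
  by have [u Hu] := choice h; exists u => t; exact: Hu.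
exists u => x e e0; have e20 : 0 < e / 2 by lra.
have [t ht] := term_limit_all x e20; exists (f t); rewrite hu.
by apply: le_lt_trans ht _; lra.
Qed.

End Separable.

(** * The zero algebra and the conclusion *)

Lemma opnorm_unique (R : realType) n (M : 'M[R[i]]_n) s : is_opnorm M s -> s = opn M.
Proof.
by have [a b] := opn_is_opnorm M => -[c d]; apply/eqP; rewrite eq_le d // b.
Qed.

Lemma RFD_zero (R : realType) (P : CStarAlg R) : (forall x : P, x = 0) -> RFD P.
Proof.
move=> P0; have n0 (x : P) : cs_norm x = 0.
  have ax := cs_ax P; have := cs_nrmZ ax 0 x.
  by rewrite -[X in cabs X]/(0%:C) cabs_real normr0 mul0r scale0r (P0 x).
split.
  by exists (fun=> 0) => x e e0; exists 0%N; rewrite n0.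
move=> a; rewrite n0; split=> [_ [n [pi [s [[_ pZ _ _] /opnorm_unique-> ->]]]]|t ht].
  by rewrite (P0 a) -(scale0r 0) pZ scale0r opn0.
(* The 0-dimensional representation makes the set of norms nonempty, so every upper bound is at
   least 0. *)
apply: ht; exists 0%N, (fun=> 0), 0; split=> //.
  by split=> *; apply/matrixP=> -[].
by have := opn_is_opnorm (0 : 'M[R[i]]_0); rewrite opn0.
Qed.

Theorem mainTheorem1 (R : realType) (A B C P : CStarAlg R)
    (phiA : C -> A) (phiB : C -> B) (vA : A -> P) (vB : B -> P) :
  unital A -> unital B -> unital C ->
  separable A -> separable B -> separable C ->
  commutative_cstar A -> commutative_cstar B -> commutative_cstar C ->
  unital_star_hom phiA -> injective phiA ->
  unital_star_hom phiB -> injective phiB ->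
  is_amalgamated_free_product phiA phiB vA vB ->
  RFD P.
Proof.
move=> [eA hA] [eB hB] _ [sA HsA] [sB HsB] _ cA cB _ [[_ _ _ phiA_star] _] _ _ _ HP.
have [[eP hP] [[AD AZ AM As] A1] [[BD BZ BM Bs] B1] com univ] := HP.
(* The zero algebra is set apart because the ring structure on a [ucstar] demands a nonzero unit. If
   [P] is nonzero, so are [A] and [B], which map to it unitally. *)
have [e0|neP] := eqVneq eP 0.
  apply: RFD_zero => x; have [<- _] := hP x.
  by rewrite e0 -[in LHS](scale0r (0 : P)) (cs_mulZl (cs_ax P)) scale0r.
have vA0 : vA 0 = 0 by rewrite -(scale0r 0) AZ scale0r.
have vB0 : vB 0 = 0 by rewrite -(scale0r 0) BZ scale0r.
have neA : eA != 0 by apply: contraNneq neP => e; rewrite -(A1 _ _ hA hP) e vA0.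
have neB : eB != 0 by apply: contraNneq neP => e; rewrite -(B1 _ _ hB hP) e vB0.
pose UA := UCStar hA neA; pose UB := UCStar hB neB; pose UP := UCStar hP neP.
pose v : uhom UA UP := @UHom R UA UP vA AD AZ AM As (A1 _ _ hA hP).
pose w : uhom UB UP := @UHom R UB UP vB BD BZ BM Bs (B1 _ _ hB hP).
split.
  exact: (@free_product_separable R UA UB UP C phiA phiB v w HP sA sB HsA HsB).
move=> a; split=> [_ [n [pi [s [Hpi /opnorm_unique-> ->]]]]|t ht].
  exact: (@fd_rep_opn_le R UP n pi Hpi a).
apply/ler_addgt0Pr => d d0.
have [N [sigma [Hs h]]] := @amalgam_fd_norming R UA UB UP C phiA phiB v w cA cB phiA_star HP a d d0.
rewrite -lerBlDr; apply: le_trans h _; apply: ht.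
by exists N, sigma, (opn (sigma a)); split=> //; exact: opn_is_opnorm.
Qed.
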